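(* Fix integers $d\ge 1$ and $p\ge 2$. There exists a constant $C_{d,p}\in(0,\infty)$ with the following property. For every sufficiently large integer $n$ there exist a measurable set $E\subseteq\mathbb{R}^d$, an $n$-point configuration $P\subseteq\mathbb{R}^d$ contained in a line, and a sequence of positive numbers $(r_j)_j$ with $r_j\to\infty$, such that \[ \underline{\mathrm{d}}(E)\ge 1-C_{d,p}\,\frac{\log n}{n} \] and $E$ contains no $\ell^p$-isometric copy of $r_jP$ for any $j$. Moreover, if $p$ is even, then the constant $C_{d,p}$ can be chosen independently of the dimension $d$, and the set $E$ can be chosen so that its density $\mathrm{d}(E)$ exists.
   Context: For a measurable set $E\subseteq\mathbb{R}^d$, $|E|$ denotes its Lebesgue measure, and its lower asymptotic density is \[ \underline{\mathrm{d}}(E):=\liminf_{R\to\infty}\frac{|E\cap[-R/2,R/2]^d|}{R^d}. \] If the actual limit exists, it is denoted $\mathrm{d}(E)$ and called the density of $E$. For $x=(x_1,\ldots,x_d)\in\mathbb{R}^d$ write $\|x\|_p:=\big(\sum_{i=1}^d|x_i|^p\big)^{1/p}$. An $n$-point configuration is a set of exactly $n$ points. For a finite set $P\subseteq\mathbb{R}^d$ and $r\in(0,\infty)$, a set $Y\subseteq\mathbb{R}^d$ is an $\ell^p$-isometric copy of $rP$ if there exists a bijection $\phi\colon P\to Y$ such that $\|\phi(u)-\phi(v)\|_p=r\|u-v\|_p$ for all $u,v\in P$. ''$E$ contains an $\ell^p$-isometric copy of $rP$'' means that some such $Y$ satisfies $Y\subseteq E$. The logarithm has base $e$. *)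

(* Defs.v *)
(* MathComp / MathComp-Analysis. Points of R^d are row vectors 'rV[R]_d. *)
From HB Require Import structures.
From mathcomp Require Import all_boot all_order all_algebra.
From mathcomp Require Import all_classical all_reals all_analysis.
Set Implicit Arguments.
Unset Strict Implicit.
Unset Printing Implicit Defensive.
Import Order.TTheory GRing.Theory Num.Theory.
Import numFieldNormedType.Exports.
Local Open Scope classical_set_scope.
Local Open Scope card_scope.
Local Open Scope ring_scope.

(* The d-fold product of the Lebesgue measure of R. The library has a product
   sigma-algebra on tuples but no product measure there, hence the iteration of
   the binary product along (x, t) |-> x :: t; its values are meaningful on
   measurable (i.e. Borel) sets, and [outer_volume] extends it to all sets. *)
Fixpoint borel_volume (R : realType) (d : nat) :
    set (d.-tuple (measurableTypeR R)) -> \bar R :=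
  match d with
  | 0%N => fun A => (\d_ [tuple] A)%E
  | d'.+1 => fun A =>
      (@lebesgue_measure R \x @borel_volume R d')%E
        [set z | A (cons_tuple z.1 z.2)]
  end.

Section lebesgue_measure_in_dimension_d.
Context (R : realType) (d : nat).
Implicit Type E : set 'rV[R]_d.

(* The library puts its sigma-algebra on tuples, so sets of row vectors are
   transported along the canonical bijection. *)
Definition tuple_set E : set (d.-tuple (measurableTypeR R)) :=
  [set t | E (\row_i tnth t i)].

(* Lebesgue outer measure on R^d (infimum over countable Borel covers). *)
Definition outer_volume : set (d.-tuple (measurableTypeR R)) -> \bar R :=
  (mu_ext (@borel_volume R d)).

(* Lebesgue (not merely Borel) measurability, in the sense of Caratheodory;
   in dimension 1 this is how the library sets up the completed Lebesgue
   measure. *)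
Definition Lebesgue_measurable E : Prop :=
  caratheodory_measurable outer_volume (tuple_set E).

(* |E|; the Lebesgue measure of E when E is Lebesgue measurable *)
Definition volume E : \bar R := outer_volume (tuple_set E).

Definition centered_cube (r : R) : set 'rV[R]_d :=
  [set x | forall i, - (r / 2) <= x 0 i <= r / 2].

Definition density_ratio E (r : R) : \bar R :=
  (volume (E `&` centered_cube r) * ((r ^+ d)^-1)%:E)%E.

Definition lower_density E : \bar R :=
  limf_einf (density_ratio E) (pinfty_nbhs R).

Definition has_density E : Prop :=
  cvg (density_ratio E r @[r --> pinfty_nbhs R]).

End lebesgue_measure_in_dimension_d.

Section configurations.
Context (R : realType) (d : nat).
Implicit Types P Y E : set 'rV[R]_d.

Definition lp_norm (p : nat) (x : 'rV[R]_d) : R :=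
  (\sum_(i < d) `|x 0 i| ^+ p) `^ (p%:R^-1).

Definition configuration (n : nat) P : Prop := P #= `I_n.

Definition in_a_line P : Prop :=
  exists a v : 'rV[R]_d, v != 0 /\ P `<=` [set a + t *: v | t in [set: R]].

Definition isometric_copy (p : nat) (r : R) P Y : Prop :=
  exists phi : 'rV[R]_d -> 'rV[R]_d, set_bij P Y phi /\
    forall u v, P u -> P v ->
      lp_norm p (phi u - phi v) = r * lp_norm p (u - v).

Definition contains_copy (p : nat) (r : R) P E : Prop :=
  exists Y, isometric_copy p r P Y /\ Y `<=` E.

End configurations.

(* Main.v *)
Require Import Defs.
From HB Require Import structures.
From mathcomp Require Import all_boot all_order all_algebra.
From mathcomp Require Import zify ring lra.

(** The configuration P consists of the points 0, e, 2e, ..., (n-1)e for a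
coordinate vector e.  Since |x|^p is strictly convex for p >= 2, equality in
the triangle inequality forces collinearity, so a copy of rP is again an
arithmetic progression y + i w, with sum_k |w_k|^p = r^p
([equal_steps_progression]).

For a sign pattern s put f_s(x) = sum_k (-1)^(s k) x_k^p.  Along y + i w this
is a polynomial in i of degree p whose leading coefficient is f_s(w)
([row_power_sum_line]).  When s is adapted to the signs of w this leading
coefficient is exactly r^p, while the lower coefficients are arbitrary reals.
For even p the trivial pattern is adapted to every w; for odd p the 2^d
patterns together are ([sign_cover]), and this is where the dependence of the
constant on d comes from.

E is the set of x such that, for every pattern s in use, floor(f_s(x)) avoids
a fixed set B of residues modulo M.  If r^p = alpha modulo M, then E contains
no copy of rP as soon as every real polynomial of degree p whose leading
coefficient is congruent to alpha modulo M has some value, at an integer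
0 <= i < n, with integer part in B modulo M.  [unavoidable_residues] finds M,
alpha and such a B of density O(log n / n).  Rounding the coefficients to a
grid leaves only polynomially many (in n) polynomials to consider.  If
alpha, and M with respect to alpha, are large powers of n, no unit cell
modulo M contains p+1 of the n values: Lagrange interpolation at those p+1
integers would express a nonzero multiple of alpha as a small number modulo M
([cell_bound]).  So each polynomial visits at least n/p cells, and a greedy
choice of about (M p / n) log(number of polynomials) cells meets them all
([greedy_hitting], [hitting_set]).

It remains to see that the set where floor(f_s) lies in B modulo M has density
#B / M ([level_set_le], applied to B and to its complement).  On a half-line
the map x |-> (x^p + 1)^(1/p) is a contraction that increases x^p by 1, and
contractions do not increase Lebesgue measure, so the level sets of two
residues differ in measure by at most M, and the M of them share the total
length.  The estimate is uniform in an additive constant, which makes it pass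
to higher dimension by integration over one coordinate. *)

Set Implicit Arguments.
Unset Strict Implicit.
Unset Printing Implicit Defensive.
Import Order.TTheory GRing.Theory Num.Theory.

(** * Greedy hitting sets *)

Section Greedy.
Variables (U I : finType) (F : I -> {set U}) (m : nat).
Hypothesis mF : forall i, m <= #|F i|.

Definition missed (A : {set U}) : {set I} := [set i | [disjoint F i & A]].

Lemma card_missed_setU1 (A : {set U}) u :
  #|missed (u |: A)| = \sum_(i in missed A) (u \notin F i).
Proof.
rewrite -sum1_card [RHS]big_mkcond [LHS]big_mkcond; apply: eq_bigr => i _ /=.
rewrite !inE !disjoints_subset setCU subsetI -disjoints_subset disjoint_sym.
by rewrite disjoints1; case: (u \in F i); case: (F i \subset _).
Qed.

Lemma sum_card_missed (A : {set U}) :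
  \sum_u #|missed (u |: A)| <= #|missed A| * (#|U| - m).
Proof.
under eq_bigr do rewrite card_missed_setU1.
rewrite exchange_big /= -sum_nat_const; apply: leq_sum => i _.
rewrite (_ : \sum_u _ = #|~: F i|); first by rewrite cardsCs setCK leq_sub2l.
by rewrite -sum1_card [RHS]big_mkcond; apply: eq_bigr => u _; rewrite inE; case: (u \in F i).
Qed.

(** An average element of [U] meets a proportion at least m / #|U| of the sets
that [A] still misses, and some element does at least as well. *)
Lemma greedy_step (A : {set U}) : 0 < #|U| ->
  exists u, #|missed (u |: A)| * #|U| <= #|missed A| * (#|U| - m).
Proof.
move=> U0; apply/existsP; apply: contraT; rewrite negb_exists => /forallP H.
have : \sum_(u : U) #|missed A| * (#|U| - m) < \sum_u #|missed (u |: A)| * #|U|.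
  have [u0 _] := card_gt0P U0.
  rewrite (bigD1 u0)//= [X in _ < X](bigD1 u0)//= -addSn leq_add//.
    by rewrite ltnNge.
  by apply: leq_sum => u _; rewrite ltnW// ltnNge.
rewrite sum_nat_const -big_distrl /= [X in _ < X]mulnC ltn_mul2l U0 /=.
by rewrite ltnNge sum_card_missed.
Qed.

(** After [k] greedy choices only a fraction (1 - m / #|U|)^k of the family is
missed; the bound is cleared of denominators. *)
Lemma greedy_hitting k : 0 < #|U| -> exists A : {set U},
  #|A| <= k /\ #|missed A| * #|U| ^ k <= #|I| * (#|U| - m) ^ k.
Proof.
move=> U0; elim: k => [|k [A [Ak HA]]].
  by exists set0; rewrite cards0 !muln1 max_card.
have [u Hu] := greedy_step A U0; exists (u |: A); split.
  by rewrite cardsU1 -add1n leq_add// leq_b1.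
rewrite expnS mulnA (leq_trans (leq_mul Hu (leqnn _)))//.
by rewrite mulnAC (leq_trans (leq_mul HA (leqnn _)))// -mulnA -expnSr.
Qed.
End Greedy.

Lemma card_le_imset_fibers (S T : finType) (f : S -> T) p :
  (forall y, #|[set x | f x == y]| <= p) -> #|S| <= #|f @: setT| * p.
Proof.
move=> fp; rewrite -[leqLHS]sum1_card (partition_big f (mem (f @: setT))) /=.
  rewrite -sum_nat_const; apply: leq_sum => y _.
  rewrite (leq_trans _ (fp y))// -sum1_card [leqRHS]big_mkcond [leqLHS]big_mkcond.
  by apply: leq_sum => x _; rewrite inE; case: (f x == y).
by move=> x _; exact: imset_f.
Qed.

(** * Interpolation at integer nodes *)

Section Interpolation.
Local Open Scope ring_scope.
Variables (p N : nat) (x : 'I_p.+1 -> nat).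
Hypothesis x_inj : injective x.
Hypothesis x_lt : forall i, (x i < N)%N.

(* The Lagrange basis is built on an injective sequence of nodes indexed by all
   of [nat]; negative nodes continue the given ones injectively. *)
Let node (k : nat) : rat := if insub k is Some i then (x i)%:R else - k.+1%:R.

Let node_ord (i : 'I_p.+1) : node i = (x i)%:R.
Proof. by rewrite /node valK. Qed.

Let node_inj : injective node.
Proof.
move=> k l; rewrite /node; case: insubP => [i _ <-|kp]; case: insubP => [j _ <-|lp].
- by move/eqP; rewrite eqr_nat => /eqP/x_inj ->.
- by move=> e; exfalso; have : (0 : rat) <= (x i)%:R by []; rewrite e oppr_ge0 lern0.
- by move=> e; exfalso; have : (0 : rat) <= (x j)%:R by []; rewrite -e oppr_ge0 lern0.
- by move/oppr_inj/eqP; rewrite eqr_nat => /eqP [].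
Qed.

(** The derivative at [x i] of the polynomial whose roots are the nodes. *)
Definition node_gap (i : 'I_p.+1) : int := \prod_(j < p.+1 | j != i) ((x i)%:Z - (x j)%:Z).

Lemma node_gap_neq0 i : node_gap i != 0.
Proof.
apply/prodf_neq0 => j ji; rewrite subr_eq0 eqz_nat.
by apply: contra ji => /eqP/x_inj ->.
Qed.

Lemma norm_node_gap i : (`|node_gap i| <= N ^ p)%N.
Proof.
rewrite -lez_nat abszE normr_prod -[Posz (N ^ p)]natz natrX natz.
apply: (@le_trans _ _ (\prod_(j < p.+1 | j != i) N%:Z)).
  apply: ler_prod => j _; rewrite normr_ge0 /=.
  by have := x_lt i; have := x_lt j; lia.
by rewrite prodr_const cardC1 card_ord.
Qed.

Lemma lagrange_lead_coef (c : nat -> int) :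
  (c p)%:~R = \sum_(i < p.+1)
    (\sum_(k < p.+1) c k * (x i)%:Z ^+ k)%:~R / (node_gap i)%:~R :> rat.
Proof.
pose q : {poly rat} := \poly_(k < p.+1) (c k)%:~R.
have := @lagrange_gen rat p.+1 node isT node_inj q (size_poly _ _).
move/(congr1 (fun r : {poly rat} => r`_p)); rewrite {1}/q coef_poly ltnSn => ->.
rewrite coef_sum; apply: eq_bigr => i _; rewrite coefCM lagrangeE// coefCM.
have nodeE : (\prod_(j < p.+1 | j != i) ('X - (node j)%:P)).[node i] = (node_gap i)%:~R.
  rewrite horner_prod rmorph_prod /=; apply: eq_bigr => j _.
  by rewrite hornerXsubC !node_ord rmorphB.
rewrite nodeE.
have monP : (\prod_(j < p.+1 | j != i) ('X - (node j)%:P)) \is monic.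
  by apply: monic_prod => j _; exact: monicXsubC.
have sizeP : size (\prod_(j < p.+1 | j != i) ('X - (node j)%:P)) = p.+1.
  rewrite size_prod => [|j _]; last by rewrite polyXsubC_eq0.
  rewrite (eq_bigr (fun=> 2%N)) => [|j _]; last by rewrite size_XsubC.
  by rewrite sum_nat_const cardC1 card_ord /=; lia.
have -> : (\prod_(j < p.+1 | j != i) ('X - (node j)%:P))`_p = 1.
  by have /monicP := monP; rewrite /lead_coef sizeP.
rewrite mulr1; congr (_ / _); rewrite horner_poly rmorph_sum /=.
by apply: eq_bigr => k _; rewrite rmorphM rmorphXn/= node_ord.
Qed.

(** Lagrange's formula for the leading coefficient, multiplied by the product
of all the node gaps so that the weights become integers.  It isolates the
coefficient of degree [p] and cancels all lower ones, whatever they are. *)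
Lemma interpolation_weights : exists (D : int) (w : 'I_p.+1 -> int),
  [/\ D != 0, (`|D| <= N ^ (p * p.+1))%N,
      forall i, (`|w i| <= N ^ (p * p.+1))%N &
      forall c : nat -> int,
        \sum_(i < p.+1) w i * (\sum_(k < p.+1) c k * (x i)%:Z ^+ k) = D * c p].
Proof.
exists (\prod_(i < p.+1) node_gap i), (fun i => \prod_(j < p.+1 | j != i) node_gap j).
split.
- by apply/prodf_neq0 => i _; exact: node_gap_neq0.
- rewrite (big_morph absz abszM (erefl _ : absz 1 = 1%N)) expnM.
  rewrite -[p.+1 in leqRHS]card_ord -prod_nat_const.
  by apply: leq_prod => i _; exact: norm_node_gap.
- move=> i; rewrite (big_morph absz abszM (erefl _ : absz 1 = 1%N)).
  apply: (@leq_trans (\prod_(j < p.+1 | j != i) N ^ p)%N).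
    by apply: leq_prod => j _; exact: norm_node_gap.
  rewrite prod_nat_const cardC1 card_ord -expnM leq_pexp2l//.
    by rewrite (leq_ltn_trans _ (x_lt i)).
  by rewrite leq_mul.
move=> c; apply: (@intr_inj rat).
rewrite [RHS]rmorphM/= lagrange_lead_coef mulr_sumr rmorph_sum/=.
apply: eq_bigr => i _; rewrite rmorphM/= [in RHS](bigD1 i)//= rmorphM/=.
have : (node_gap i)%:~R != 0 :> rat by rewrite intr_eq0 node_gap_neq0.
by move=> h; field.
Qed.
End Interpolation.

(** If p+1 values of a polynomial lie in one cell of length G modulo M G, then
the interpolation weights, whose sum is zero, cancel the position of the cell:
D alpha G equals a multiple of M G up to an error at most (p+1) B G, where
B = N^(p(p+1)) bounds the weights.  But |D| alpha lies strictly between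
(p+1) B and M - (p+1) B. *)
Lemma cell_bound (p N G M alpha kappa : nat) (a : nat -> nat) (x : 'I_p.+1 -> nat) :
  0 < p -> 0 < G -> injective x -> (forall i, x i < N) ->
  p.+1 * N ^ (p * p.+1) < alpha ->
  N ^ (p * p.+1) * alpha + p.+1 * N ^ (p * p.+1) < M ->
  (forall i, ((alpha * G * x i ^ p + \sum_(k < p) a k * x i ^ k) %/ G) %% M = kappa) ->
  False.
Proof.
move=> p0 G0 x_inj x_lt; set B := N ^ (p * p.+1) => al_big M_big cell.
have [D [w [D0 DB wB wE]]] := interpolation_weights x_inj x_lt.
rewrite -/B in DB wB.
pose v i := alpha * G * x i ^ p + \sum_(k < p) a k * x i ^ k.
pose m i := (v i %/ G) %/ M; pose rho i := v i %% G.
have vE i : v i = G * (kappa + M * m i) + rho i.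
  rewrite {1}(divn_eq (v i) G) mulnC /rho; congr (_ * _ + _).
  by rewrite {1}(divn_eq (v i %/ G) M) cell addnC mulnC.
have rhoG i : rho i < G by rewrite ltn_pmod.
(* The weights annihilate constants because p > 0. *)
have sumw : (\sum_(i < p.+1) w i = 0)%R.
  have := wE (fun k => (k == 0)%:R%R).
  rewrite (gtn_eqF p0) mulr0 => {2}<-; apply: eq_bigr => i _.
  by rewrite big_ord_recl /= expr0 mulr1 big1 ?addr0 ?mulr1// => k _; rewrite mul0r.
pose Z : int := (\sum_(i < p.+1) w i * (m i)%:Z)%R.
pose E : int := (\sum_(i < p.+1) w i * (rho i)%:Z)%R.
have key : (D * (alpha%:Z * G%:Z) = G%:Z * M%:Z * Z + E)%R.
  have := wE (fun k => if k == p then Posz (alpha * G) else Posz (a k)).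
  rewrite eqxx PoszM => <-.
  transitivity (\sum_(i < p.+1) w i * (v i)%:Z)%R.
    apply: eq_bigr => i _; congr (_ * _)%R.
    rewrite big_ord_recr /= eqxx /v addrC PoszD PoszM -[Posz (x i ^ p)]natz natrX natz.
    rewrite PoszM -[Posz (\sum_(k < p) _)]natz natr_sum; congr (_ + _)%R.
    apply: eq_bigr => k _; rewrite (ltn_eqF (ltn_ord k)) natrM natrX !natz.
    by [].
  have <- : (Posz G * Posz kappa * (\sum_(i < p.+1) w i) + (Posz G * Posz M * Z + E) =
    Posz G * Posz M * Z + E)%R by rewrite sumw mulr0 add0r.
  rewrite /Z /E !mulr_sumr -!big_split /=.
  by apply: eq_bigr => i _; rewrite vE PoszD PoszM PoszD PoszM; ring.
have E_le : (`|E| <= Posz (p.+1 * B * G)%N)%R.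
  apply: (le_trans (ler_norm_sum _ _ _)).
  apply: (@le_trans _ _ (\sum_(i < p.+1) Posz (B * G)%N)%R).
    apply: ler_sum => i _; rewrite normrM PoszM -abszE.
    by apply: ler_pM => //; rewrite ?lez_nat//= ltnW.
  by rewrite sumr_const card_ord -mulr_natr natz !PoszM mulrC mulrA.
have D1 : (1 <= `|D| <= B%:Z)%R.
  by apply/andP; split; rewrite -abszE lez_nat ?absz_gt0.
have normD : (`|D| * (alpha%:Z * G%:Z) <= G%:Z * M%:Z * `|Z| + `|E|)%R.
  have := ler_normD (G%:Z * M%:Z * Z)%R E.
  by rewrite -key !normrM !(ger0_norm (le0z_nat _)).
have normZ : (G%:Z * M%:Z * `|Z| <= `|D| * (alpha%:Z * G%:Z) + `|E|)%R.
  have := ler_normB (D * (alpha%:Z * G%:Z))%R E.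
  by rewrite {1}key addrK !normrM !(ger0_norm (le0z_nat _)).
have GZ : (0 < G%:Z)%R by rewrite ltz_nat.
move: E_le; rewrite !PoszM mulrC => E_le.
have al_bigZ : (p.+1%:Z * B%:Z < alpha%:Z)%R by rewrite -PoszM ltz_nat.
have M_bigZ : (B%:Z * alpha%:Z + p.+1%:Z * B%:Z < M%:Z)%R by rewrite -!PoszM -PoszD ltz_nat.
have [D1a D1b] := andP D1.
have [Z0|Z0] := eqVneq Z 0%R.
  have h : (`|D| * alpha%:Z <= p.+1%:Z * B%:Z)%R.
    rewrite -(ler_pM2l GZ); apply: (le_trans _ E_le).
    by move: normD; rewrite Z0 normr0 mulr0 add0r mulrA mulrC.
  have : (alpha%:Z <= `|D| * alpha%:Z)%R by apply: ler_peMl.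
  by move=> h'; have := le_lt_trans (le_trans h' h) al_bigZ; rewrite ltxx.
have Z1 : (1 <= `|Z|)%R by rewrite -abszE lez_nat absz_gt0.
have h : (M%:Z * `|Z| <= `|D| * alpha%:Z + p.+1%:Z * B%:Z)%R.
  rewrite -(ler_pM2l GZ) mulrA mulrDr; apply: (le_trans normZ).
  by apply: lerD => //; rewrite mulrA mulrC.
have h1 : (M%:Z <= M%:Z * `|Z|)%R by apply: ler_peMr.
have h2 : (`|D| * alpha%:Z <= B%:Z * alpha%:Z)%R by apply: ler_wpM2r.
lia.
Qed.

(** G times the value at i of a polynomial of leading coefficient alpha whose
lower coefficients lie in the grid of multiples of 1/G. *)
Definition int_poly_value (p alpha G : nat) (a : nat -> nat) (i : nat) :=
  alpha * G * i ^ p + \sum_(k < p) a k * i ^ k.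

Definition nat_extension (p m : nat) (a : 'I_p -> 'I_m) (l : nat) : nat :=
  if insub l is Some l' then a l' else 0.

(** By [cell_bound] the n values of each polynomial occupy at least n/p cells,
and there are (M G)^p polynomials modulo M with coefficients in the grid. *)
Lemma hitting_set (p n G M alpha k : nat) :
  0 < p -> 0 < G ->
  p.+1 * n ^ (p * p.+1) < alpha ->
  n ^ (p * p.+1) * alpha + p.+1 * n ^ (p * p.+1) < M ->
  (M * G) ^ p * (M - (n + p.-1) %/ p) ^ k < M ^ k ->
  exists A : {set 'I_M}, #|A| <= k /\
    forall a : 'I_p -> 'I_(M * G), exists i : 'I_n, exists2 j : 'I_M, j \in A &
      (int_poly_value p alpha G (nat_extension a) i %/ G) %% M = j.
Proof.
move=> p0 G0 al_big M_big k_big.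
have M0 : 0 < M by apply: leq_ltn_trans M_big.
pose ext (a : {ffun 'I_p -> 'I_(M * G)}) := nat_extension a.
pose cell a (i : 'I_n) : 'I_M :=
  Ordinal (ltn_pmod (int_poly_value p alpha G (ext a) i %/ G) M0).
pose F a := cell a @: setT.
have Fm a : (n + p.-1) %/ p <= #|F a|.
  have : n <= #|F a| * p.
    rewrite -[leqLHS]card_ord; apply: card_le_imset_fibers => y.
    rewrite leqNgt; apply/negP => fib.
    pose x (i : 'I_p.+1) : 'I_n := enum_val (widen_ord fib i).
    apply: (@cell_bound p n G M alpha y (ext a) (fun i => x i : nat)) => //.
    - by move=> i j /val_inj /enum_val_inj /(congr1 val) /= /val_inj.
    move=> i; have := enum_valP (widen_ord fib i); rewrite inE => /eqP/(congr1 val).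
    by rewrite -/(x i).
  by move=> nF; rewrite -ltnS ltn_divLR//; lia.
have [|A [Ak HA]] := greedy_hitting Fm k.
  by rewrite card_ord.
exists A; split=> // a.
have miss0 : missed F A = set0.
  apply/eqP; rewrite -cards_eq0 -leqn0 -ltnS.
  rewrite -(@ltn_pmul2r (M ^ k)) ?expn_gt0 ?M0// mul1n.
  rewrite card_ord in HA; apply: (leq_ltn_trans HA).
  by rewrite card_ffun !card_ord.
have : [ffun l => a l] \notin missed F A by rewrite miss0 inE.
rewrite inE -setI_eq0 => /set0Pn[j]; rewrite inE => /andP[/imsetP[i _ ->] iA].
exists i, (cell [ffun l => a l] i) => //=.
congr (_ %/ _ %% _); congr (_ + _); apply: eq_bigr => l _; rewrite /ext /nat_extension.
by congr (_ * _); case: insubP => // l' _ _; rewrite ffunE.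
Qed.

(** * Sets of integers determined by residues *)

Section PeriodicSets.
Local Open Scope ring_scope.

Definition int_periodic (M : nat) (b : pred int) := forall k, b (k + M%:Z) = b k.
Definition residue_count (M : nat) (b : pred int) := (\sum_(s < M) b s%:Z)%N.

Lemma residue_count_shift M b k : int_periodic M b ->
  (\sum_(s < M) b (k + s%:Z)%R)%N = residue_count M b.
Proof.
move=> bM; rewrite /residue_count.
have step j : (\sum_(s < M) b (j + 1 + s%:Z)%R)%N = (\sum_(s < M) b (j + s%:Z)%R)%N.
  case: M bM => [|M] bM; first by rewrite !big_ord0.
  rewrite big_ord_recr big_ord_recl /= addnC addr0; congr addn.
    by congr nat_of_bool; rewrite -(bM j); congr b; lia.
  by apply: eq_bigr => i _; congr nat_of_bool; congr b; rewrite /bump/=; lia.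
elim/int_rect: k => [|n IH|n IH].
- by apply: eq_bigr => i _; rewrite add0r.
- by rewrite -IH -(step n%:Z); apply: eq_bigr => i _; congr nat_of_bool; congr b; lia.
- by rewrite -IH -(step (- n.+1%:Z)); apply: eq_bigr => i _; congr nat_of_bool; congr b; lia.
Qed.

Lemma residue_countC M b : residue_count M (predC b) = (M - residue_count M b)%N.
Proof.
apply/eqP; rewrite -(eqn_add2r (residue_count M b)).
have h : (\sum_(s < M) (b s%:Z + predC b s%:Z) = M)%N.
  by rewrite (eq_bigr (fun=> 1%N)) ?sum1_card ?card_ord// => i _ /=; case: b.
rewrite big_split /= in h.
by apply/eqP; rewrite /residue_count /=; lia.
Qed.

End PeriodicSets.

Section Residues.
Local Open Scope ring_scope.
Variables (M : nat) (A : {set 'I_M}).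

Definition residue_in (z : int) : bool := [exists j in A, (z %% M%:Z)%Z == (val j)%:Z].

(** Rounding the coefficients of a polynomial down to the grid lowers its values
at the integers below n by less than 1, so the integer part after rounding is
the true one or the one below it. *)
Definition thickened (z : int) : bool := residue_in z || residue_in (z - 1).

Lemma residue_in_periodic : int_periodic M residue_in.
Proof. by move=> z; rewrite /residue_in modzDr. Qed.

Lemma thickened_periodic : int_periodic M thickened.
Proof. by move=> z; rewrite /thickened addrAC !residue_in_periodic. Qed.

Lemma residue_count_in : residue_count M residue_in = #|A|.
Proof.
rewrite /residue_count -sum1_card [RHS]big_mkcond; apply: eq_bigr => s _.
rewrite /residue_in modz_small; last by rewrite /= ltz_nat ltn_ord.
case: ifPn => sA.
  by rewrite (introT existsP)//; exists s; rewrite sA /=.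
case: existsP => // -[j /andP[jA /eqP [sj]]]; move: sA.
by rewrite (_ : s = j) ?jA//; exact: val_inj.
Qed.

Lemma residue_count_thickened : (residue_count M thickened <= 2 * #|A|)%N.
Proof.
rewrite mul2n -addnn -residue_count_in.
rewrite -[X in (_ <= X + _)%N](residue_count_shift (-1) residue_in_periodic).
rewrite /residue_count -big_split /=.
apply: leq_sum => s _; rewrite /thickened (addrC _ (-1)).
by case: residue_in; case: residue_in.
Qed.
End Residues.

From mathcomp Require Import all_classical all_reals all_analysis.
From mathcomp Require Import measurable_realfun.
Import numFieldNormedType.Exports.
Local Open Scope classical_set_scope.
Local Open Scope ring_scope.

(** * Residues that no polynomial with a prescribed leading coefficient avoids *)

Section UnavoidableResidues.
Variable R : realType.

(** Modulo M the coefficients may be reduced as well as rounded, because the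
polynomial is evaluated at integers; the multiples of M removed are collected
in z. *)
Lemma floor_rounded_poly (p n M G alpha j : nat) (c : nat -> R) :
  (0 < M)%N -> (0 < G)%N -> (p * n ^ p < G)%N ->
  exists a : 'I_p -> 'I_(M * G), forall i : nat, (i < n)%N ->
    let v := int_poly_value p alpha G (nat_extension a) i in
    let u := Num.floor ((alpha + j * M)%:R * i%:R ^+ p + \sum_(k < p) c k * i%:R ^+ k) in
    exists z : int, u = (v %/ G)%N%:Z + M%:Z * z \/ u = (v %/ G)%N%:Z + M%:Z * z + 1.
Proof.
move=> M0 G0 pnG; have MG0 : (0 < M * G)%N by rewrite muln_gt0 M0.
pose A (k : nat) : int := Num.floor (G%:R * c k).
have amod k : (`|(A k %% (M * G)%N%:Z)%Z| < M * G)%N.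
  by have := @modz_ge0 (A k) (M * G)%N%:Z; have := @ltz_pmod (A k) (M * G)%N%:Z; lia.
exists (fun k => Ordinal (amod k)) => i i_lt v u.
(* The rounding errors, in units of 1/G. *)
pose theta (k : nat) : R := G%:R * c k - (A k)%:~R.
have theta01 k : 0 <= theta k < 1.
  rewrite subr_ge0 ltrBlDl floor_le /=; have := floorD1_gt (G%:R * c k).
  by rewrite intrD.
pose th : R := \sum_(k < p) theta k * i%:R ^+ k.
have th0 : 0 <= th.
  by apply: sumr_ge0 => k _; rewrite mulr_ge0 ?exprn_ge0//; case/andP: (theta01 k).
have thG : th < G%:R.
  apply: (@le_lt_trans _ _ (p * n ^ p)%:R); last by rewrite ltr_nat.
  rewrite (_ : (p * n ^ p)%:R = \sum_(k < p) (n ^ p)%:R); last first.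
    by rewrite sumr_const card_ord mulnC natrM mulr_natr.
  apply: ler_sum => k _; rewrite -natrX -[leRHS]mul1r.
  apply: ler_pM => //; first by case/andP: (theta01 k).
    by case/andP: (theta01 k) => _ /ltW.
  rewrite ler_nat (@leq_trans (n ^ k))//.
    by case: (nat_of_ord k) => // k'; rewrite leq_exp2r// ltnW.
  rewrite leq_pexp2l//.
    by rewrite (leq_ltn_trans _ i_lt).
  exact: ltnW.
pose q (k : nat) : int := (A k %/ (M * G)%N%:Z)%Z.
pose z : int := (j * i ^ p)%N%:Z + \sum_(k < p) q k * (i ^ k)%N%:Z.
exists z.
have main : G%:R * ((alpha + j * M)%:R * i%:R ^+ p + \sum_(k < p) c k * i%:R ^+ k) =
   v%:R + (M%:R * G%:R) * z%:~R + th.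
  have AE k : A k = q k * (M * G)%N%:Z + `|(A k %% (M * G)%N%:Z)%Z|%N%:Z.
    rewrite {1}(divz_eq (A k) (M * G)%N%:Z) abszE ger0_norm ?modz_ge0//.
    by rewrite eqz_nat -lt0n.
  have cE k : G%:R * c k = theta k + (q k)%:~R * (M%:R * G%:R) +
      `|(A k %% (M * G)%N%:Z)%Z|%N%:R.
    have e : (A k)%:~R = (q k)%:~R * (M%:R * G%:R) +
        `|(A k %% (M * G)%N%:Z)%Z|%N%:R :> R.
      by rewrite {1}AE intrD intrM -natrM.
    by rewrite /theta e; ring.
  pose a k : nat := `|(A k %% (M * G)%N%:Z)%Z|%N.
  have vR : v%:R = alpha%:R * G%:R * i%:R ^+ p + \sum_(k < p) (a k)%:R * i%:R ^+ k :> R.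
    rewrite /v /int_poly_value natrD !natrM natrX natr_sum; congr (_ + _).
    by apply: eq_bigr => k _; rewrite natrM natrX /nat_extension valK.
  have zR : z%:~R = j%:R * i%:R ^+ p + \sum_(k < p) (q k)%:~R * i%:R ^+ k :> R.
    rewrite /z intrD rmorph_sum /= pmulrn -natrX -natrM; congr (_ + _).
    by apply: eq_bigr => k _; rewrite intrM /= -natrX.
  have sumE : G%:R * (\sum_(k < p) c k * i%:R ^+ k) =
      th + (M%:R * G%:R) * (\sum_(k < p) (q k)%:~R * i%:R ^+ k) +
      \sum_(k < p) (a k)%:R * i%:R ^+ k.
    rewrite /th !mulr_sumr -!big_split /=; apply: eq_bigr => k _.
    by rewrite mulrA cE; ring.
  by rewrite mulrDr sumE vR zR natrD natrM; ring.
have vE : v%:R = (v %/ G)%N%:R * G%:R + (v %% G)%N%:R :> R.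
  by rewrite -natrM -natrD -divn_eq.
have rhoG : (v %% G)%N%:R <= G%:R - 1 :> R.
  by rewrite lerBrDr natr1 ler_nat ltn_pmod.
have GR : 0 < G%:R :> R by rewrite ltr0n.
pose y : R := (alpha + j * M)%:R * i%:R ^+ p + \sum_(k < p) c k * i%:R ^+ k.
pose t := (v %/ G)%N.
rewrite /u -/y -/t; rewrite -/y in main; rewrite -/t in vE.
pose f : R := ((v %% G)%N%:R + th) / G%:R.
have yE : y = (t%:Z + M%:Z * z)%:~R + f.
  apply: (mulfI (lt0r_neq0 GR)); rewrite main vE intrD intrM -!pmulrn /f.
  by field; exact: lt0r_neq0.
have f0 : 0 <= f by rewrite divr_ge0// addr_ge0.
have f2 : f < 2 by rewrite ltr_pdivrMr//; lra.
set w := _ + M%:Z * z in yE *; clearbody w f.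
have [f1|f1] := ltP f 1; [left|right]; apply: floor_def; rewrite yE !intrD !mulr1z.
  by apply/andP; split; lra.
by apply/andP; split; lra.
Qed.

(** Comes from (1 - m/M)^k <= exp (- k m / M), with k the first integer above
(M / m) ln I. *)
Lemma enough_greedy_steps (I M m : nat) : (0 < I)%N -> (0 < m <= M)%N ->
  exists k : nat, (I * (M - m) ^ k < M ^ k)%N /\
    k%:R <= M%:R / m%:R * ln I%:R + 1 :> R.
Proof.
move=> I0 /andP[m0 mM]; have M0 : (0 < M)%N by exact: leq_trans mM.
have mR : 0 < m%:R :> R by rewrite ltr0n.
have MR : 0 < M%:R :> R by rewrite ltr0n.
have IR : 0 < I%:R :> R by rewrite ltr0n.
pose y : R := M%:R / m%:R * ln I%:R.
have y0 : 0 <= y by rewrite mulr_ge0 ?divr_ge0 ?ln_ge0 ?ler1n.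
exists (Num.truncn y).+1; split; last first.
  by rewrite -natr1 lerD2r; case/andP: (truncn_itv y0).
set k := (Num.truncn y).+1.
have yk : y < k%:R by case/andP: (truncn_itv y0).
rewrite -(ltr_nat R) natrM !natrX natrB//.
have base : M%:R - m%:R <= M%:R * expR (- (m%:R / M%:R)) :> R.
  have := expR_ge1Dx (- (m%:R / M%:R) : R); rewrite -(ler_pM2l MR).
  by rewrite mulrDr mulr1 mulrN [M%:R * (m%:R / _)]mulrC divfK ?gt_eqF.
have mM0 : 0 <= M%:R - m%:R :> R by rewrite subr_ge0 ler_nat.
have step : (M%:R - m%:R) ^+ k <= M%:R ^+ k * expR (- (k%:R * (m%:R / M%:R))) :> R.
  rewrite -mulrN expRM_natl -exprMn; apply: lerXn2r => //.
  by rewrite nnegrE (le_trans mM0).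
apply: (@le_lt_trans _ _ (I%:R * (M%:R ^+ k * expR (- (k%:R * (m%:R / M%:R)))))).
  by rewrite ler_pM2l.
rewrite mulrCA -[ltRHS]mulr1 ltr_pM2l ?exprn_gt0//.
rewrite -{1}(lnK (_ : I%:R \in Num.pos))// -expRD -[ltRHS]expR0 ltr_expR subr_lt0.
rewrite -(ltr_pM2l (_ : 0 < M%:R / m%:R :> R)) ?divr_gt0//.
apply: (lt_le_trans yk); rewrite le_eqVlt; apply/orP; left; apply/eqP.
by field; rewrite !gt_eqF.
Qed.

(** With e = p(p+1), the choices alpha = n^(e+2), M = n^(2e+4) and G = n^(p+1)
satisfy the hypotheses of [hitting_set] for n > p+2, and M G is a power n^K with
K depending only on p, so that the logarithm of the number of polynomials is
p K ln n. *)
Lemma unavoidable_residues p : (0 < p)%N -> exists C : R, 0 < C /\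
  forall n : nat, (p.+2 < n)%N ->
  exists (M alpha : nat) (b : pred int),
    [/\ (0 < M)%N, (0 < alpha)%N, int_periodic M b,
        (residue_count M b)%:R / M%:R <= C * (ln n%:R / n%:R) :> R &
        forall (c : nat -> R) (j : nat), exists i : nat, (i < n)%N /\
          b (Num.floor ((alpha + j * M)%:R * i%:R ^+ p + \sum_(k < p) c k * i%:R ^+ k))].
Proof.
move=> p0; pose e := (p * p.+1)%N; pose K := (e + e + 4 + p.+1)%N.
exists (2 * (p * (p * K))%:R + 2); split; first by rewrite ltr_wpDl.
move=> n pn; have n0 : (0 < n)%N by exact: leq_trans pn.
have n1 : (1 < n)%N by apply: leq_ltn_trans pn.
pose alpha := (n ^ (e + 2))%N; pose M := (n ^ (e + e + 4))%N; pose G := (n ^ p.+1)%N.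
have npow a : (0 < n ^ a)%N by rewrite expn_gt0 n0.
have M0 : (0 < M)%N := npow _.
have G0 : (0 < G)%N := npow _.
pose m := ((n + p.-1) %/ p)%N.
have nM : (n <= M)%N by rewrite /M -[leqLHS]expn1 leq_exp2l//; lia.
have m_pos : (0 < m)%N by rewrite divn_gt0//; lia.
have mn : (m <= n)%N.
  by rewrite -ltnS ltn_divLR//; nia.
have nmp : (n <= m * p)%N.
  by have := ltn_pmod (n + p.-1) p0; have := divn_eq (n + p.-1) p; rewrite -/m; lia.
have I0 : (0 < (M * G) ^ p)%N by rewrite expn_gt0 muln_gt0 M0 G0.
have mM : (0 < m <= M)%N by rewrite m_pos (leq_trans mn).
have [k [k_big k_le]] := enough_greedy_steps I0 mM.
have al_big : (p.+1 * n ^ (p * p.+1) < alpha)%N.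
  rewrite /alpha expnD mulnC ltn_pmul2l// expnS expn1; nia.
have M_big : (n ^ (p * p.+1) * alpha + p.+1 * n ^ (p * p.+1) < M)%N.
  have h1 : (n ^ (p * p.+1) * alpha = n ^ (e + e + 2))%N by rewrite -expnD addnA.
  have h2 : (alpha <= n ^ (e + e + 2))%N by rewrite leq_exp2l//; lia.
  have h3 : (M = n * n * n ^ (e + e + 2))%N.
    by rewrite -mulnA -!expnS; congr (_ ^ _)%N; lia.
  rewrite h1 h3; apply: (@leq_trans (2 * n ^ (e + e + 2))%N).
    by rewrite mul2n -addnn ltn_add2l (leq_trans al_big).
  by rewrite leq_mul2r; rewrite (leq_trans n1) ?orbT// leq_pmulr.
have [A [Ak HA]] := hitting_set p0 G0 al_big M_big k_big.
exists M, alpha, (thickened A); split=> //.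
- exact: npow.
- exact: thickened_periodic.
- have nR : 0 < n%:R :> R by rewrite ltr0n.
  have mR : 0 < m%:R :> R by rewrite ltr0n.
  have MR : 0 < M%:R :> R by rewrite ltr0n.
  have ln1 : 1 <= ln n%:R :> R.
    (* ln n >= ln 4 = - 2 ln (1/2) >= 1. *)
    have half : ln (2^-1 : R) <= - 2^-1.
      by have := @le_ln1Dx R (- 2^-1); rewrite (_ : 1 - 2^-1 = 2^-1 :> R); [apply; lra|lra].
    rewrite lnV ?posrE// in half.
    apply: (@le_trans _ _ (ln ((2 : R) ^+ 2))).
      by rewrite lnXn// mulr2n; lra.
    by rewrite ler_ln ?posrE ?exprn_gt0// -natrX ler_nat; lia.
  have cnt : (residue_count M (thickened A))%:R <=
      2 * (M%:R / m%:R * ln ((M * G) ^ p)%N%:R + 1) :> R.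
    apply: le_trans (_ : (2 * k)%:R <= _).
      by rewrite ler_nat (leq_trans (residue_count_thickened A))// leq_mul2l Ak orbT.
    by rewrite natrM ler_pM2l.
  have lnI : ln ((M * G) ^ p)%N%:R = (p * K)%:R * ln n%:R :> R.
    rewrite -expnD -expnM natrX lnXn// [RHS]mulr_natl; congr (_ *+ _).
    by rewrite mulnC.
  have minv : m%:R^-1 <= p%:R / n%:R :> R.
    by rewrite ler_pdivlMr// mulrC ler_pdivrMr// -natrM ler_nat mulnC.
  rewrite ler_pdivrMr//; apply: (le_trans cnt); rewrite lnI.
  have ln0 : 0 <= ln n%:R :> R by exact: le_trans ln1.
  have h1 : M%:R / m%:R * ((p * K)%:R * ln n%:R) <=
      M%:R * (p%:R / n%:R) * ((p * K)%:R * ln n%:R) :> R.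
    by apply: ler_wpM2r; [rewrite mulr_ge0|rewrite ler_pM2l].
  have h2 : 1 <= M%:R / n%:R * ln n%:R :> R.
    rewrite -[leLHS]mulr1; apply: ler_pM => //.
    by rewrite ler_pdivlMr// mul1r ler_nat.
  apply: (@le_trans _ _ (2 * (M%:R * (p%:R / n%:R) * ((p * K)%:R * ln n%:R) +
      M%:R / n%:R * ln n%:R))); first by rewrite ler_pM2l// lerD.
  by rewrite !natrM le_eqVlt; apply/orP; left; apply/eqP; ring.
move=> c j.
have pG : (p * n ^ p < G)%N by rewrite /G expnS ltn_pmul2r//; lia.
have [a Ha] := floor_rounded_poly alpha j c M0 G0 pG.
have [i [j' j'A cellE]] := HA a.
exists i; split=> //; have [z] := Ha i (ltn_ord i).
set u := Num.floor _; set t := (_ %/ G)%N in cellE *.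
have tA : residue_in A (t%:Z + M%:Z * z).
  apply/existsP; exists j'; rewrite j'A /=.
  by rewrite addrC mulrC modzMDl modz_nat cellE.
by rewrite /thickened; case=> ->; rewrite ?addrK tA ?orbT.
Qed.

End UnavoidableResidues.

(** * Level sets of a power on the line *)

Section Contraction.
Variable R : realType.
Local Notation lambda := (@lebesgue_measure R).

(** A contraction maps an interval into an interval of the same length, so it
carries a cover by intervals to one that is not longer. *)
Lemma lebesgue_measure_contraction (T : R -> R) (D : set R) :
  (forall x y, `|T x - T y| <= `|x - y|) ->
  (lambda (T @` D) <= lambda D)%E.
Proof.
move=> lipT.
rewrite [leRHS]/lebesgue_measure /lebesgue_stieltjes_measure.
apply: le_ereal_inf_tmp => _ [F [mF DF] <-].
have TDF : T @` D `<=` \bigcup_k (T @` F k).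
  by move=> _ [x /DF[k _ Fkx] <-]; exists k => //; exists x.
apply: (@le_trans _ _ (lambda (\bigcup_k (T @` F k)))).
  exact: le_mu_ext.
apply: (@le_trans _ _ (\sum_(k <oo) lambda (T @` F k))%E).
  apply: (mu_ext_sigma_subadditive (mu := wlength idfun)) => //.
apply: lee_nneseries => // k _.
have [[a b] _ /= abF] := mF k.
rewrite -abF.
have [ab|ba] := ltP a b; last by rewrite set_itv_ge ?bnd_simp -?leNgt// image_set0 wlength0 measure0.
pose m := (a + b) / 2.
apply: (@le_trans _ _ (lambda `[T m - (b - a) / 2, T m + (b - a) / 2])).
  apply: le_mu_ext => // y [x /=]; rewrite !in_itv/= => /andP[ax xb] <-.
  rewrite -ler_distl (le_trans (lipT _ _))// ler_distl /m.
  by apply/andP; split; lra.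
rewrite lebesgue_measure_itv/= wlength_itv/= !lte_fin ab.
rewrite ifT; last by lra.
by rewrite -!EFinD lee_fin; lra.
Qed.
End Contraction.

Section OneDim.
Variable R : realType.
Local Notation lambda := (@lebesgue_measure R).

Lemma measurable_floor_pred (b : pred int) :
  measurable ([set u | b (Num.floor u)] : set (measurableTypeR R)).
Proof.
rewrite (_ : mkset _ =
   \bigcup_(k in [set: int])
     (if b k then `[k%:~R, (k + 1)%:~R[%classic else set0)).
  apply: countable_bigcupT_measurable => [|k]; first exact: countableP.
  by case: ifP => _ //; exact: measurable_itv.
apply/seteqP; split=> [u /= bu|u [k _]].
  by exists (Num.floor u) => //=; rewrite bu /= in_itv/= floor_itv.
by case: ifP => // bk; rewrite /= in_itv/= => /floor_def ->.
Qed.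

Lemma ler_subXX (p : nat) (t u h : R) : 0 <= u -> u <= t -> 0 <= h ->
  (u + h) ^+ p - u ^+ p <= (t + h) ^+ p - t ^+ p.
Proof.
move=> u0 ut h0; rewrite !subrXX !(addrAC _ h) !subrr !add0r ler_wpM2l//.
apply: ler_sum => i _.
by apply: ler_pM; rewrite ?exprn_ge0 ?addr_ge0// lerXn2r ?nnegrE ?addr_ge0 ?lerD2r// (le_trans u0).
Qed.

(** On the half-line this is the map x |-> (x^p + 1)^(1/p) that raises the p-th
power by one. *)
Definition shift_root (p : nat) (x : R) := (Num.max x 0 ^+ p + 1) `^ (p%:R^-1).

Lemma shift_rootX p x : (0 < p)%N -> 0 <= x -> shift_root p x ^+ p = x ^+ p + 1.
Proof.
move=> p0 x0; rewrite /shift_root max_l// -powR_mulrn ?powR_ge0// -powRrM mulVf.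
  by rewrite powRr1// addr_ge0 ?exprn_ge0.
by rewrite pnatr_eq0 -lt0n.
Qed.

(** The increment of the p-th power over a step h grows with the base point, and
[shift_root p x] >= x on the half-line. *)
Lemma shift_root_lipschitz p (p0 : (0 < p)%N) x y :
  `|shift_root p x - shift_root p y| <= `|x - y|.
Proof.
wlog xy : x y / x <= y.
  by move=> H; case: (leP x y) => [/H//|/ltW/H]; rewrite distrC [leRHS]distrC.
have smax z : shift_root p z = shift_root p (Num.max z 0).
  by rewrite /shift_root -maxA maxxx.
rewrite (smax x) (smax y).
set u := Num.max x 0; set v := Num.max y 0.
have u0 : 0 <= u by rewrite le_max lexx orbT.
have uv : u <= v by rewrite ge_max !le_max xy lexx orbT.
have v0 := le_trans u0 uv.
have vuyx : v - u <= y - x.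
  by rewrite /u /v; case: (leP x 0) => ?; case: (leP y 0) => ?; lra.
apply: (@le_trans _ _ (v - u)); last by rewrite distrC ger0_norm// subr_ge0.
have su0 : 0 <= shift_root p u by exact: powR_ge0.
have sv0 : 0 <= shift_root p v by exact: powR_ge0.
have su : u <= shift_root p u.
  by rewrite -(@ler_pXn2r _ p)// shift_rootX// lerDl.
have suv : shift_root p u <= shift_root p v.
  by rewrite -(@ler_pXn2r _ p)// !shift_rootX// lerD2r lerXn2r.
rewrite distrC ger0_norm ?subr_ge0// lerBlDl.
have vu0 : 0 <= v - u by rewrite subr_ge0.
rewrite -(@ler_pXn2r _ p)// ?nnegrE; last exact: addr_ge0.
rewrite (shift_rootX p0 v0).
have := @ler_subXX p (shift_root p u) u (v - u) u0 su vu0.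
by rewrite (addrC u (v - u)) subrK shift_rootX//; lra.
Qed.

Definition power_level (p : nat) (e : bool) (b : pred int) (c X : R) : set R :=
  [set x | 0 <= x <= X /\ b (Num.floor ((-1) ^+ e * x ^+ p + c))].

Lemma measurable_power_level p e b c X :
  measurable (power_level p e b c X : set (measurableTypeR R)).
Proof.
rewrite (_ : power_level _ _ _ _ _ =
  `[0, X]%classic `&` (fun x => (-1) ^+ e * x ^+ p + c) @^-1` [set u | b (Num.floor u)]).
  apply: measurableI; first exact: measurable_itv.
  rewrite -[X in measurable X]setTI.
  have mf : measurable_fun [set: measurableTypeR R] (fun x : R => (-1) ^+ e * x ^+ p + c).
    apply: measurable_funD; last exact: measurable_cst.
    by apply: measurable_funM; [exact: measurable_cst|exact: exprn_measurable].
  by apply: mf => //; exact: measurable_floor_pred.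
by apply/seteqP; split => x /=; rewrite in_itv/=.
Qed.

(** Up to the segment [0, 1], the level set at [c] is contained in the image of
the next one under the contraction [shift_root]. *)
Lemma power_level_shift p e b c X : (0 < p)%N -> 0 <= X ->
  (lambda (power_level p e b c X) <=
   lambda (power_level p e b (c + (-1) ^+ e) X) + 1)%E.
Proof.
move=> p0 X0.
(* A point y > 1 of the level set is the image of (y^p - 1)^(1/p). *)
have sub : power_level p e b c X `<=`
   (shift_root p @` power_level p e b (c + (-1) ^+ e) X) `|` `[0, 1]%classic.
  move=> y [/andP[y0 yX] byc].
  have [y1|y1] := leP y 1; first by right; rewrite /= in_itv/= y0.
  left; have yp1 : 0 <= y ^+ p - 1 by rewrite subr_ge0 exprn_ege1// ltW.
  pose x := (y ^+ p - 1) `^ (p%:R^-1).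
  have x0 : 0 <= x by exact: powR_ge0.
  have xp : x ^+ p = y ^+ p - 1.
    by rewrite -powR_mulrn// -powRrM mulVf ?powRr1// pnatr_eq0 -lt0n.
  exists x; last first.
    apply/eqP; rewrite -(@eqrXn2 _ p)// ?powR_ge0//.
    by rewrite shift_rootX// xp subrK.
  split; last by rewrite xp; congr (b (Num.floor _)): byc; ring.
  rewrite x0 (le_trans _ yX)// -(@ler_pXn2r _ p)//.
  by rewrite xp gerBl.
apply: (@le_trans _ _ (lambda ((shift_root p @` power_level p e b (c + (-1) ^+ e) X) `|` `[0, 1]%classic))).
  exact: le_mu_ext.
apply: (@le_trans _ _ (lambda (shift_root p @` power_level p e b (c + (-1) ^+ e) X) + lambda (`[0%R, 1%R]%classic : set R))%E).
  exact: (outer_measureU2 (mu_ext (wlength idfun))).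
apply: leeD; first exact: lebesgue_measure_contraction (shift_root_lipschitz p0).
by rewrite lebesgue_measure_itv/= lte_fin ltr01 sube0.
Qed.

Lemma power_level_shiftn p e b c (X : R) n : (0 < p)%N -> 0 <= X ->
  (lambda (power_level p e b c X) <=
   lambda (power_level p e b (c + (-1) ^+ e * n%:R) X) + n%:R%:E)%E.
Proof.
move=> p0 X0; elim: n => [|n IH]; first by rewrite mulr0 !addr0.
apply: (le_trans IH); rewrite [in leRHS]mulrS EFinD addeA leeD2r//.
rewrite mulrDr mulr1 (addrC ((-1) ^+ e)) addrA.
exact: power_level_shift.
Qed.

Lemma residue_count_signed M b (e : bool) k : int_periodic M b ->
  (\sum_(s < M) b (k + (-1) ^+ e * s%:Z)%R)%N = residue_count M b.
Proof.
move=> bM; case: e; last first.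
  by rewrite -(residue_count_shift k bM); under eq_bigr do rewrite mul1r.
rewrite -(residue_count_shift (k - M%:Z + 1) bM) (reindex_inj rev_ord_inj)/=.
apply: eq_bigr => i _; congr nat_of_bool; congr b.
by have := ltn_ord i; lia.
Qed.

Lemma floor_add_signed (x : R) (e : bool) (s : nat) :
  Num.floor (x + (-1) ^+ e * s%:R) = Num.floor x + (-1) ^+ e * s%:Z.
Proof.
have -> : (-1) ^+ e * s%:R = ((-1) ^+ e * s%:Z)%:~R :> R.
  by rewrite rmorphM/= rmorphXn/= rmorphN1.
rewrite floorDrz; last exact: intr_int.
by congr (_ + _); exact: intrKfloor.
Qed.

(** The M level sets obtained by shifting [c] through a period cover each point
of [0, X] as often as [b] has residues; by [power_level_shiftn] each of them
has, up to M, at least the measure of the first. *)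
Lemma power_level_le p e b M c (X : R) : (0 < p)%N -> (0 < M)%N -> int_periodic M b -> 0 <= X ->
  (lambda (power_level p e b c X) <=
   ((residue_count M b)%:R / M%:R * X + M%:R)%:E)%E.
Proof.
move=> p0 M0 bM X0.
set m := fun s : nat => power_level p e b (c + (-1) ^+ e * s%:R) X.
have mm s : measurable (m s : set (measurableTypeR R)) by exact: measurable_power_level.
have lamX : lambda `[0, X]%classic = X%:E.
  rewrite lebesgue_measure_itv/= lte_fin; case: ltP => h; first by rewrite sube0.
  by congr EFin; lra.
have sumE : (\sum_(s < M) lambda (m s) = ((residue_count M b)%:R * X)%:E)%E.
  transitivity (\sum_(s < M) \int[lambda]_(x in `[0%R, X]) (\1_(m s) x)%:E)%E.
    apply: eq_bigr => s _.
    rewrite integral_indic//; congr (lambda _).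
    by apply/seteqP; split=> x /=; rewrite /m /power_level/= in_itv/=; tauto.
  rewrite -ge0_integral_sum//; last first.
    by move=> s; apply/measurable_EFinP; exact: measurable_indic.
  rewrite (eq_integral (fun=> (residue_count M b)%:R%:E)); last first.
    move=> x; rewrite inE/= in_itv/= => x0X.
    rewrite -(residue_count_signed e (Num.floor ((-1) ^+ e * x ^+ p + c)) bM).
    rewrite natr_sum sumEFin; congr EFin; apply: eq_bigr => s _.
    rewrite indicE; congr (_%:R); congr nat_of_bool.
    by apply/idP/idP; rewrite inE /m /power_level/= addrA floor_add_signed//; case.
  rewrite integral_cst//= EFinM; congr (_ * _)%E; exact: lamX.
have mfin : lambda (power_level p e b c X) \is a fin_num.
  rewrite ge0_fin_numE//; apply: (@le_lt_trans _ _ X%:E); last by rewrite ltry.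
  by rewrite -lamX; apply: le_mu_ext => // x [] /=; rewrite in_itv.
have Msum : (\sum_(s < M) lambda (power_level p e b c X) <=
             \sum_(s < M) (lambda (m s) + M%:R%:E))%E.
  apply: lee_sum => s _; apply: (le_trans (power_level_shiftn _ _ _ s p0 X0)).
  by rewrite leeD2l// lee_fin ler_nat ltnW.
move: Msum; rewrite big_split/= sumE -(fineK mfin) !sumEFin -EFinD !lee_fin.
rewrite !sumr_const !card_ord -(mulr_natr (fine _)) -(mulr_natr M%:R).
move=> H; rewrite -(ler_pM2r (_ : 0 < M%:R)) ?ltr0n// (le_trans H)//.
have : M%:R != 0 :> R by rewrite pnatr_eq0 -lt0n.
by move=> Mn0; rewrite le_eqVlt; apply/orP; left; apply/eqP; field.
Qed.
End OneDim.

(** * The iterated Lebesgue measure *)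

Section IteratedMeasure.
Variable R : realType.
Local Notation lambda := (@lebesgue_measure R).
Local Notation tup d := (d.-tuple (measurableTypeR R)).

Definition uncurry_cons d (z : measurableTypeR R * tup d) : tup d.+1 :=
  cons_tuple z.1 z.2.

Lemma measurable_uncurry_cons d : measurable_fun setT (@uncurry_cons d).
Proof. exact: (@measurable_cons _ _ _ _ fst d snd). Qed.

Section ConsMeasure.
Variables (d : nat) (mu : {sigma_finite_measure set (tup d) -> \bar R}).

Definition cons_measure : set (tup d.+1) -> \bar R :=
  pushforward (lambda \x mu)%E (@uncurry_cons d).

Let measurable_uncons (A : set (tup d.+1)) :
  measurable A -> measurable (@uncurry_cons d @^-1` A).
Proof.
by move=> mA; rewrite -[X in measurable X]setTI; exact: measurable_uncurry_cons.
Qed.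

Let cons_measure0 : cons_measure set0 = 0%E.
Proof. by rewrite /cons_measure /pushforward preimage_set0 measure0. Qed.

Let cons_measure_ge0 A : (0 <= cons_measure A)%E.
Proof. by apply: integral_ge0 => *. Qed.

Let cons_measure_sigma_additive : semi_sigma_additive cons_measure.
Proof.
move=> F mF tF mUF; rewrite /cons_measure /pushforward preimage_bigcup.
apply: measure_semi_sigma_additive => [i||].
- exact: measurable_uncons.
- apply/trivIsetP => /= i j _ _ ij; rewrite -preimage_setI.
  by move/trivIsetP : tF => /(_ _ _ _ _ ij) ->//; rewrite preimage_set0.
- by rewrite -preimage_bigcup; exact: measurable_uncons.
Qed.

HB.instance Definition _ := isMeasure.Build _ _ _ cons_measure
  cons_measure0 cons_measure_ge0 cons_measure_sigma_additive.

Let cons_sigma_finite : sigma_finite setT cons_measure.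
Proof.
have /sigma_finiteP[F [FT ndF Foo]] := sigma_finiteT lambda.
have /sigma_finiteP[G [GT ndG Goo]] := sigma_finiteT mu.
pose uncons (t : tup d.+1) := (thead t, [tuple of behead t]) : measurableTypeR R * tup d.
have muncons : measurable_fun setT uncons.
  by apply: measurable_fun_pair; [exact: measurable_tnth|exact: measurable_behead].
exists (fun n => uncons @^-1` (F n `*` G n)).
  apply/seteqP; split=> // t _.
  have [n _ Fn] : (\bigcup_n F n) (uncons t).1 by rewrite -FT.
  have [m _ Gm] : (\bigcup_n G n) (uncons t).2 by rewrite -GT.
  exists (maxn n m) => //; split.
    by move: Fn; apply/subsetPset/ndF/leq_maxl.
  by move: Gm; apply/subsetPset/ndG/leq_maxr.
move=> n; have [mF lF] := Foo n; have [mG muG] := Goo n; split.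
  by rewrite -[X in measurable X]setTI; apply: muncons => //; exact: measurableX.
rewrite /cons_measure /pushforward (_ : _ @^-1` _ = F n `*` G n).
  by rewrite product_measure1E// lte_mul_pinfty// ge0_fin_numE.
apply/seteqP; split=> -[x t] /=; rewrite /uncons /uncurry_cons/= theadE;
  by have -> : [tuple of behead (cons_tuple x t)] = t by apply: val_inj.
Qed.

HB.instance Definition _ := Measure_isSigmaFinite.Build _ _ _ cons_measure cons_sigma_finite.
End ConsMeasure.

(** [borel_volume] is defined as a bare set function; identifying it with a
sigma-finite measure gives access to measurability of sections and to the
comparison with the outer measure that it generates. *)
Lemma borel_volume_is_measure d :
  exists mu : {sigma_finite_measure set (tup d) -> \bar R},
    @borel_volume R d = mu.
Proof.
elim: d => [|d [mu IH]].
  by exists (\d_ [tuple] : {sigma_finite_measure set (tup 0) -> \bar R})%E.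
exists (cons_measure mu : {sigma_finite_measure set (tup d.+1) -> \bar R}).
by apply/funext => A; rewrite /= IH.
Qed.
End IteratedMeasure.

(** * Level sets of signed power sums *)

Section Levels.
Implicit Types b : pred int.
Variable R : realType.
Local Notation lambda := (@lebesgue_measure R).
Local Notation tup d := (d.-tuple (measurableTypeR R)).

Definition tuple_cube d (X : R) : set (tup d) :=
  [set t | forall i, - X <= tnth t i <= X].

Definition signed_power_sum (s : nat -> bool) p d (t : tup d) : R :=
  \sum_(i < d) (-1) ^+ s i * tnth t i ^+ p.

Definition level_set s p b d (X c : R) : set (tup d) :=
  [set t | tuple_cube X t /\ b (Num.floor (signed_power_sum s p t + c))].

Lemma lebesgue_measure_segment (X : R) : 0 <= X ->
  lambda `[- X, X]%classic = (2 * X)%:E.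
Proof.
move=> X0; rewrite lebesgue_measure_itv/= lte_fin; case: ltP => h.
  by rewrite -EFinB; congr EFin; lra.
by congr EFin; lra.
Qed.

Lemma cons_tuple_cube d (X x : R) (t : tup d) :
  tuple_cube X (cons_tuple x t) <-> (- X <= x <= X /\ tuple_cube X t).
Proof.
split=> [H|[H1 H2] i].
  split; first by have := H ord0; rewrite tnth0.
  by move=> i; have := H (lift ord0 i); rewrite tnthS.
by case: (unliftP ord0 i) => [j ->|->]; rewrite ?tnthS ?tnth0.
Qed.

Lemma measurable_tuple_cube d X : measurable (@tuple_cube d X).
Proof.
rewrite (_ : tuple_cube X = \bigcap_(i in [set: 'I_d])
   ((fun t : tup d => tnth t i) @^-1` `[- X, X]%classic)).
  apply: fin_bigcap_measurable => [|i _]; first exact: finite_finset.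
  have mtnth := @measurable_tnth _ (measurableTypeR R) d i.
  rewrite -[X in measurable X]setTI; refine (mtnth measurableT _ _).
  exact: measurable_itv.
apply/seteqP; split=> t H.
  by move=> i _ /=; rewrite in_itv/=; exact: H.
by move=> i; have := H i I; rewrite /= in_itv.
Qed.

Lemma measurable_signed_power_sum s p d :
  measurable_fun [set: tup d] (@signed_power_sum s p d : _ -> R).
Proof.
apply: measurable_sum => i; apply: measurable_funM; first exact: measurable_cst.
by apply: measurable_funX; exact: measurable_tnth.
Qed.

Lemma measurable_floor_signed_power_sum s p b d c :
  measurable [set t : tup d | b (Num.floor (signed_power_sum s p t + c))].
Proof.
have mf : measurable_fun [set: tup d] (fun t => signed_power_sum s p t + c).
  apply: measurable_funD; last exact: measurable_cst.
  exact: measurable_signed_power_sum.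
rewrite -[X in measurable X]setTI; exact: (mf measurableT _ (measurable_floor_pred b)).
Qed.

Lemma measurable_level_set s p b d X c : measurable (@level_set s p b d X c).
Proof.
exact: measurableI (@measurable_tuple_cube d X)
  (@measurable_floor_signed_power_sum s p b d c).
Qed.

Lemma borel_volume_cube d X : 0 <= X ->
  borel_volume (@tuple_cube d X) = ((2 * X) ^+ d)%:E.
Proof.
move=> X0; elim: d => [|d IH].
  by rewrite /= diracE mem_set//= => -[].
rewrite /=; have [mu muE] := borel_volume_is_measure R d; rewrite muE.
rewrite (_ : mkset _ = `[- X, X]%classic `*` @tuple_cube d X).
  have mc := @measurable_tuple_cube d X.
  rewrite product_measure1E//.
  by rewrite -muE IH exprS EFinM; congr (_ * _)%E; exact: lebesgue_measure_segment.
by apply/seteqP; split=> -[x t] /=; rewrite in_itv/= cons_tuple_cube.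
Qed.

(** Integration over the first coordinate of a uniform bound on the sections. *)
Lemma borel_volumeS_le d (A : set (tup d.+1)) (X V : R) : 0 <= X -> 0 <= V ->
  measurable A ->
  (forall x t, A (cons_tuple x t) -> - X <= x <= X) ->
  (forall x, borel_volume [set t : tup d | A (cons_tuple x t)] <= V%:E)%E ->
  (borel_volume A <= (2 * X * V)%:E)%E.
Proof.
move=> X0 V0 mA AX AV /=.
have [mu muE] := borel_volume_is_measure R d; rewrite muE in AV *.
have mA' : measurable (@uncurry_cons R d @^-1` A).
  by rewrite -[X in measurable X]setTI; exact: measurable_uncurry_cons.
rewrite -/(uncurry_cons _) /product_measure1.
apply: (@le_trans _ _ (\int[lambda]_x (\1_(`[- X, X]%classic : set R) x * V)%:E)%E); last first.
  under eq_integral do rewrite EFinM.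
  rewrite ge0_integralZr//=; last by apply/measurable_EFinP; exact: measurable_indic.
  rewrite integral_indic// setIT EFinM lee_pmul//.
  by rewrite le_eqVlt; apply/orP; left; apply/eqP; exact: lebesgue_measure_segment.
apply: ge0_le_integral => //=.
- exact: (measurable_fun_xsection mu mA').
- apply/measurable_EFinP; apply: measurable_funM; last exact: measurable_cst.
  exact: measurable_indic.
move=> x _; rewrite indicE.
have xE : xsection (@uncurry_cons R d @^-1` A) x = [set t : tup d | A (cons_tuple x t)].
  by apply/seteqP; split=> t; rewrite /xsection/= inE.
have [xX|xX] := boolP (x \in _).
  by rewrite mul1r xE; exact: AV.
rewrite mul0r xE (_ : mkset _ = set0) ?measure0//.
apply/seteqP; split=> // t /AX; move: xX; rewrite notin_setE/= in_itv/=.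
by move=> /[apply].
Qed.

Lemma signed_power_sum_cons s p d (x : R) (t : tup d) :
  signed_power_sum s p (cons_tuple x t) =
  (-1) ^+ s 0%N * x ^+ p + signed_power_sum (s \o S) p t.
Proof.
rewrite /signed_power_sum big_ord_recl tnth0; congr (_ + _).
by apply: eq_bigr => i _; rewrite tnthS.
Qed.

Lemma level_set_cons s p b d (X c x : R) : - X <= x <= X ->
  [set t : tup d | @level_set s p b d.+1 X c (cons_tuple x t)] =
  @level_set (s \o S) p b d X (c + (-1) ^+ s 0%N * x ^+ p).
Proof.
move=> xX; apply/seteqP.
have e t : signed_power_sum s p (cons_tuple x t) + c =
    signed_power_sum (s \o S) p t + (c + (-1) ^+ s 0%N * x ^+ p).
  by rewrite signed_power_sum_cons; ring.
split=> t; rewrite /level_set/= cons_tuple_cube xX e; first by move=> [[]].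
by move=> [].
Qed.

Lemma borel_volume1 (A : set (tup 1)) : measurable A ->
  borel_volume A = lambda [set x | A [tuple x]].
Proof.
move=> mA; rewrite /borel_volume.
have mA1 : measurable [set x : measurableTypeR R | A [tuple x]].
  have m1 : measurable_fun setT (fun x : measurableTypeR R => cons_tuple x [tuple]).
    by apply: (@measurable_cons _ _ _ _ id 0 (fun=> [tuple])) => //; exact: measurable_cst.
  have := m1 measurableT _ mA; rewrite setTI.
  congr (measurable _); apply/seteqP; split=> x /=; congr A; exact: val_inj.
rewrite (_ : mkset _ = [set x : measurableTypeR R | A [tuple x]] `*` [set: tup 0]).
  rewrite product_measure1E//= diracE mem_set// mule1//.
apply/seteqP; split=> -[x t] /=; rewrite (tuple0 t).
  by move=> Axt; split=> //; congr A: Axt; exact: val_inj.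
by move=> [Axt _]; congr A: Axt; exact: val_inj.
Qed.

Lemma signed_power_level_le p (e : bool) b M (c X : R) :
  (0 < p)%N -> (0 < M)%N -> int_periodic M b -> 0 <= X ->
  (lambda [set x : R | - X <= x <= X /\ b (Num.floor ((-1) ^+ e * x ^+ p + c))]%R <=
   ((residue_count M b)%:R / M%:R * (2 * X) + 2 * M%:R)%:E)%E.
Proof.
move=> p0 M0 bM X0.
(* On the negative half-line x^p is the p-th power of -x, up to the sign
   (-1)^p. *)
apply: (@le_trans _ _ (lambda (power_level p e b c X `|`
    -%R @` power_level p (e (+) odd p) b c X))%E).
  apply: le_mu_ext => // x [/andP[xX1 xX2] bx].
  have [x0|x0] := leP 0 x; first by left; split; rewrite ?x0.
  right; exists (- x); last by rewrite opprK.
  split; first by rewrite oppr_ge0 (ltW x0) lerNl.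
  rewrite (exprNn x) mulrA -(signr_odd _ p) -signr_addb.
  by rewrite -addbA addbb addbF.
apply: (@le_trans _ _ (lambda (power_level p e b c X) +
    lambda (-%R @` power_level p (e (+) odd p) b c X))%E).
  exact: (outer_measureU2 (mu_ext (wlength idfun))).
have lipN (x y : R) : `|- x - - y| <= `|x - y| by rewrite -opprD normrN.
rewrite (_ : _ + 2 * _ = (residue_count M b)%:R / M%:R * X + M%:R +
   ((residue_count M b)%:R / M%:R * X + M%:R)); last by ring.
rewrite EFinD; apply: leeD; first exact: power_level_le.
by apply: le_trans (power_level_le _ _ p0 M0 bM X0);
   exact: lebesgue_measure_contraction.
Qed.

(** The section at a first coordinate x is a level set of the same kind in which
(-1)^(s 0) x^p has been added to [c]; this is why the bound has to be uniform in
[c]. *)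
Lemma level_set_le s p b M d (X c : R) :
  (0 < p)%N -> (0 < M)%N -> int_periodic M b -> 0 <= X ->
  (borel_volume (@level_set s p b d.+1 X c) <=
   ((2 * X) ^+ d * ((residue_count M b)%:R / M%:R * (2 * X) + 2 * M%:R))%:E)%E.
Proof.
move=> p0 M0 bM X0; elim: d s c => [|d IH] s c.
  rewrite mul1r borel_volume1; last exact: measurable_level_set.
  apply: le_trans (signed_power_level_le (s 0%N) c p0 M0 bM X0).
  apply: le_mu_ext => // x; rewrite /level_set/=.
  rewrite (_ : [tuple x] = cons_tuple x [tuple]); last exact: val_inj.
  rewrite cons_tuple_cube signed_power_sum_cons => -[[-> _]].
  by rewrite /signed_power_sum big_ord0 addr0.
rewrite exprS -mulrA; apply: borel_volumeS_le => //.
- by rewrite mulr_ge0 ?exprn_ge0 ?addr_ge0 ?mulr_ge0 ?divr_ge0.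
- exact: measurable_level_set.
- by move=> x t [/cons_tuple_cube[]].
move=> x; have [xX|xX] := boolP (- X <= x <= X).
  by rewrite level_set_cons.
rewrite (_ : mkset _ = set0).
  have [mu ->] := borel_volume_is_measure R d.+1.
  by rewrite measure0 lee_fin mulr_ge0 ?exprn_ge0 ?addr_ge0 ?mulr_ge0 ?divr_ge0.
by apply/seteqP; split=> // t [/cons_tuple_cube[]]; rewrite (negbTE xX).
Qed.
End Levels.

(** * Density *)

Section Density.
Variable R : realType.
Implicit Types (b : pred int) (T : seq (nat -> bool)).
Local Notation tup d := (d.-tuple (measurableTypeR R)).

Lemma Lebesgue_measurable_borel d (E : set 'rV[R]_d) :
  measurable (tuple_set E) -> Lebesgue_measurable E.
Proof.
move=> mE; rewrite /Lebesgue_measurable /outer_volume.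
have [mu ->] := borel_volume_is_measure R d.
exact: caratheodory_measurable_mu_ext.
Qed.

Lemma volume_borel d (E : set 'rV[R]_d) :
  measurable (tuple_set E) -> volume E = borel_volume (tuple_set E).
Proof.
move=> mE; rewrite /volume /outer_volume.
have [mu ->] := borel_volume_is_measure R d.
exact: measurable_mu_extE.
Qed.

Definition row_power_sum (s : nat -> bool) p d (x : 'rV[R]_d) : R :=
  \sum_(i < d) (-1) ^+ s i * x 0 i ^+ p.

Definition avoiding_set T p b d : set 'rV[R]_d :=
  [set x | forall s, List.In s T -> ~~ b (Num.floor (row_power_sum s p x))].

Lemma row_power_sum_tuple s p d (t : tup d) :
  row_power_sum s p (\row_i tnth t i) = signed_power_sum s p t.
Proof. by apply: eq_bigr => i _; rewrite mxE. Qed.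

Lemma tuple_set_avoiding_cons s T p b d :
  tuple_set (@avoiding_set (s :: T) p b d) =
  [set t | ~~ b (Num.floor (signed_power_sum s p t + 0))] `&`
  tuple_set (@avoiding_set T p b d).
Proof.
apply/seteqP; split=> t; rewrite /tuple_set/= addr0 -row_power_sum_tuple.
  by move=> H; split=> [|s' s'T]; [apply: H; left|apply: H; right].
by move=> [H1 H2] s' /= [<- //|s'T]; exact: H2.
Qed.

Lemma tuple_set_avoiding_nil p b d : tuple_set (@avoiding_set [::] p b d) = setT.
Proof. by apply/seteqP; split=> // t _ s' []. Qed.

Lemma measurable_avoiding_set T p b d :
  measurable (tuple_set (@avoiding_set T p b d)).
Proof.
elim: T => [|s T IH]; first by rewrite tuple_set_avoiding_nil; exact: measurableT.
rewrite tuple_set_avoiding_cons; apply: measurableI => //.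
exact: (@measurable_floor_signed_power_sum R s p (predC b) d 0).
Qed.

Lemma tuple_set_cube d (E : set 'rV[R]_d) r :
  tuple_set (E `&` @centered_cube R d r) = tuple_cube (r / 2) `&` tuple_set E.
Proof.
rewrite setIC; apply/seteqP; split=> t [H1 H2]; split=> // i.
  by have := H1 i; rewrite mxE.
by rewrite mxE; exact: H1.
Qed.

(** A union bound over the patterns of [T]. *)
Lemma borel_volume_avoiding_ge T p b M d (X : R) :
  (0 < p)%N -> (0 < M)%N -> int_periodic M b -> 0 <= X ->
  (((2 * X) ^+ d.+1 - (size T)%:R * ((2 * X) ^+ d *
     ((residue_count M b)%:R / M%:R * (2 * X) + 2 * M%:R)))%:E <=
   borel_volume (tuple_cube X `&` tuple_set (@avoiding_set T p b d.+1)))%E.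
Proof.
move=> p0 M0 bM X0; elim: T => [|s T IH].
  by rewrite tuple_set_avoiding_nil setIT borel_volume_cube// mul0r subr0.
set V := (_ ^+ d * _) in IH *.
set A := tuple_cube X `&` _ in IH *.
have [mu muE] := borel_volume_is_measure R d.+1.
have mL : measurable (@level_set R s p b d.+1 X 0) by exact: measurable_level_set.
have mA' : measurable (tuple_cube X `&` tuple_set (@avoiding_set (s :: T) p b d.+1)).
  by apply: measurableI; [exact: measurable_tuple_cube|exact: measurable_avoiding_set].
have sub : A `<=` (tuple_cube X `&` tuple_set (@avoiding_set (s :: T) p b d.+1)) `|`
                  @level_set R s p b d.+1 X 0.
  move=> t [cubet At]; rewrite tuple_set_avoiding_cons.
  have [bt|bt] := boolP (b (Num.floor (signed_power_sum s p t + 0))).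
    by right.
  by left; split.
have muA : (mu A <= mu (tuple_cube X `&` tuple_set (@avoiding_set (s :: T) p b d.+1)) + V%:E)%E.
  apply: (@le_trans _ _ (mu ((tuple_cube X `&` tuple_set (@avoiding_set (s :: T) p b d.+1)) `|` @level_set R s p b d.+1 X 0))).
    apply: le_measure => //; rewrite inE; last exact: measurableU.
    by apply: measurableI; [exact: measurable_tuple_cube|exact: measurable_avoiding_set].
  apply: (le_trans (measureU2 _ _ _)) => //.
  by rewrite leeD2l//; have := @level_set_le R s p b M d X 0 p0 M0 bM X0; rewrite muE.
rewrite muE in IH *.
rewrite -(leeD2rE _ _ (_ : V%:E \is a fin_num))//.
apply: le_trans muA; apply: le_trans IH.
by rewrite -EFinD lee_fin /= -natr1; lra.
Qed.

(** For a single pattern the avoiding set is itself a level set, of the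
complementary residues, so that the upper bound of [level_set_le] applies. *)
Lemma borel_volume_avoiding1_le s p b M d (X : R) :
  (0 < p)%N -> (0 < M)%N -> int_periodic M b -> 0 <= X ->
  (borel_volume (tuple_cube X `&` tuple_set (@avoiding_set [:: s] p b d.+1)) <=
   ((2 * X) ^+ d *
     ((1 - (residue_count M b)%:R / M%:R) * (2 * X) + 2 * M%:R))%:E)%E.
Proof.
move=> p0 M0 bM X0.
have bM' : int_periodic M (predC b) by move=> k /=; rewrite bM.
have M0R : M%:R != 0 :> R by rewrite pnatr_eq0 -lt0n.
rewrite (_ : 1 - _ = (residue_count M (predC b))%:R / M%:R :> R); last first.
  rewrite residue_countC natrB ?mulrBl ?divff//.
  rewrite -[leqRHS]card_ord -sum1_card /residue_count.
  by apply: leq_sum => i _; exact: leq_b1.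
rewrite (_ : _ `&` _ = @level_set R s p (predC b) d.+1 X 0); first exact: level_set_le.
by rewrite tuple_set_avoiding_cons tuple_set_avoiding_nil setIT.
Qed.

Lemma density_ratio_avoidingE T p b d (r : R) :
  density_ratio (@avoiding_set T p b d) r =
  (borel_volume (tuple_cube (r / 2) `&` tuple_set (@avoiding_set T p b d)) *
   ((r ^+ d)^-1)%:E)%E.
Proof.
rewrite /density_ratio volume_borel tuple_set_cube//.
by apply: measurableI; [exact: measurable_tuple_cube|exact: measurable_avoiding_set].
Qed.

Lemma density_ratio_avoiding_ge T p b M d (r : R) :
  (0 < p)%N -> (0 < M)%N -> int_periodic M b -> 0 < r ->
  ((1 - (size T)%:R * ((residue_count M b)%:R / M%:R + 2 * M%:R / r))%:E <=
   density_ratio (@avoiding_set T p b d.+1) r)%E.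
Proof.
move=> p0 M0 bM r0; rewrite density_ratio_avoidingE.
have r2 : 0 <= r / 2 by rewrite divr_ge0// ltW.
rewrite (_ : _%:E = ((((2 * (r / 2)) ^+ d.+1 - (size T)%:R * ((2 * (r / 2)) ^+ d *
     ((residue_count M b)%:R / M%:R * (2 * (r / 2)) + 2 * M%:R)))%:E * ((r ^+ d.+1)^-1)%:E)%E)); last first.
  rewrite -EFinM; congr EFin; rewrite (_ : 2 * (r / 2) = r); last by field.
  rewrite exprS; field.
  by rewrite pnatr_eq0 -lt0n M0 expf_neq0 gt_eqF.
by apply: lee_wpmul2r; [rewrite lee_fin invr_ge0 exprn_ge0// ltW|exact: borel_volume_avoiding_ge].
Qed.

Lemma density_ratio_avoiding1_le s p b M d (r : R) :
  (0 < p)%N -> (0 < M)%N -> int_periodic M b -> 0 < r ->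
  (density_ratio (@avoiding_set [:: s] p b d.+1) r <=
   (1 - (residue_count M b)%:R / M%:R + 2 * M%:R / r)%:E)%E.
Proof.
move=> p0 M0 bM r0; rewrite density_ratio_avoidingE.
have r2 : 0 <= r / 2 by rewrite divr_ge0// ltW.
rewrite (_ : (1 - _ + _)%:E = (((2 * (r / 2)) ^+ d *
     ((1 - (residue_count M b)%:R / M%:R) * (2 * (r / 2)) + 2 * M%:R))%:E * ((r ^+ d.+1)^-1)%:E)%E); last first.
  rewrite -EFinM; congr EFin; rewrite (_ : 2 * (r / 2) = r); last by field.
  rewrite exprS; field.
  by rewrite pnatr_eq0 -lt0n M0 expf_neq0 gt_eqF.
by apply: lee_wpmul2r; [rewrite lee_fin invr_ge0 exprn_ge0// ltW|exact: borel_volume_avoiding1_le].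
Qed.

Lemma lower_density_avoiding_ge T p b M d (e : R) :
  (0 < p)%N -> (0 < M)%N -> int_periodic M b -> 0 < e ->
  ((1 - (size T)%:R * ((residue_count M b)%:R / M%:R + e))%:E <=
   lower_density (@avoiding_set T p b d.+1))%E.
Proof.
move=> p0 M0 bM e0; rewrite /lower_density limf_einfE.
have M0R : 0 < M%:R :> R by rewrite ltr0n.
(* The boundary error 2 M / r is at most e for r > K. *)
pose K := 2 * M%:R / e.
have K0 : 0 < K by rewrite divr_gt0// mulr_gt0.
apply: (@le_trans _ _ (ereal_inf
    (density_ratio (@avoiding_set T p b d.+1) @` [set r | K < r]))); last first.
  apply: ereal_sup_ubound; exists [set r | K < r] => //.
  by exists K; split=> //; exact: num_real.
apply: le_ereal_inf_tmp => _ [r /= Kr <-].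
have r0 : 0 < r by exact: lt_trans Kr.
apply: le_trans (density_ratio_avoiding_ge T d p0 M0 bM r0).
rewrite lee_fin lerD2l lerN2 ler_wpM2l// lerD2l.
by rewrite ler_pdivrMr// (mulrC e) -ler_pdivrMr// ltW.
Qed.

Lemma has_density_avoiding1 s p b M d :
  (0 < p)%N -> (0 < M)%N -> int_periodic M b ->
  has_density (@avoiding_set [:: s] p b d.+1).
Proof.
move=> p0 M0 bM; pose rho : R := (residue_count M b)%:R / M%:R.
have cK : (2 * M%:R / r : R) @[r --> +oo] --> 0.
  apply/cvgrPdist_lt => e e0; near=> r.
  have r0 : 0 < r by near: r; exact: nbhs_pinfty_gt.
  rewrite sub0r normrN ger0_norm ?divr_ge0 ?mulr_ge0 ?(ltW r0)//.
  rewrite ltr_pdivrMr// (mulrC e) -ltr_pdivrMr//.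
  by near: r; apply: nbhs_pinfty_gt; exact: num_real.
apply: (@cvgP _ _ (1 - rho)%:E).
apply: (@squeeze_cvge _ _ _ _ (fun r => (1 - rho - 2 * M%:R / r)%:E) _
   (fun r => (1 - rho + 2 * M%:R / r)%:E)).
- near=> r; have r0 : 0 < r by near: r; exact: nbhs_pinfty_gt.
  apply/andP; split; last exact: density_ratio_avoiding1_le.
  apply: le_trans (density_ratio_avoiding_ge _ _ p0 M0 bM r0).
  by rewrite lee_fin /= mul1r opprD addrA.
- apply: cvg_EFin; first by near=> r.
  rewrite -[X in _ --> X]subr0; apply: cvgB => //; exact: cvg_cst.
- apply: cvg_EFin; first by near=> r.
  rewrite -[X in _ --> X]addr0; apply: cvgD => //; exact: cvg_cst.
Unshelve. all: by end_near.
Qed.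

End Density.

(** * Rigidity of copies of an arithmetic progression *)

Section Geometry.
Variable R : realType.

(** The induction step is Chebyshev's inequality
(a - b)(a^q - b^q) >= 0. *)
Lemma midpoint_powX_lt q (a b : R) : 0 <= a -> 0 <= b -> a != b ->
  ((a + b) / 2) ^+ q.+2 < (a ^+ q.+2 + b ^+ q.+2) / 2.
Proof.
move=> a0 b0 ab.
have ab2 : 0 < (a - b) ^+ 2 by rewrite exprn_even_gt0//= subr_eq0.
have m0 : 0 < (a + b) / 2.
  rewrite divr_gt0// lt0r addr_ge0// andbT paddr_eq0//.
  by apply: contra ab => /andP[/eqP-> /eqP->].
elim: q => [|q IH]; first by rewrite !expr2 in ab2 *; nra.
rewrite exprS (exprS a) (exprS b).
apply: (@lt_le_trans _ _ ((a + b) / 2 * ((a ^+ q.+2 + b ^+ q.+2) / 2))).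
  by rewrite ltr_pM2l.
have : 0 <= (a - b) * (a ^+ q.+2 - b ^+ q.+2).
  have [h|/ltW h] := leP a b.
    by rewrite mulr_le0 ?subr_le0// lerXn2r.
  by rewrite mulr_ge0 ?subr_ge0// lerXn2r.
by nra.
Qed.

Lemma midpoint_normX_lt p (x y : R) : (2 <= p)%N -> x != y ->
  (`|x + y| / 2) ^+ p < (`|x| ^+ p + `|y| ^+ p) / 2.
Proof.
case: p => [//|[//|q]] _ xy.
have [exy|nxy] := eqVneq `|x| `|y|; last first.
  apply: le_lt_trans (midpoint_powX_lt q (normr_ge0 x) (normr_ge0 y) nxy).
  by rewrite lerXn2r ?nnegrE ?divr_ge0 ?addr_ge0// ler_pM2r ?invr_gt0// ler_normD.
have yx : y = - x.
  by move/eqP: exy; rewrite eqr_norm2 (negbTE xy) /= => /eqP ->; rewrite opprK.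
have x0 : x != 0 by apply: contra xy => /eqP x0; rewrite yx x0 oppr0.
by rewrite yx subrr normr0 mul0r expr0n normrN divr_gt0// addr_gt0// exprn_gt0// normr_gt0.
Qed.

Lemma lp_normX d p (x : 'rV[R]_d) : (0 < p)%N ->
  lp_norm p x ^+ p = \sum_(i < d) `|x 0 i| ^+ p.
Proof.
move=> p0; rewrite /lp_norm -powR_mulrn ?powR_ge0// -powRrM mulVf ?powRr1//.
  by apply: sumr_ge0 => i _; rewrite exprn_ge0.
by rewrite pnatr_eq0 -lt0n.
Qed.

Lemma lp_norm_ge0 d p (x : 'rV[R]_d) : 0 <= lp_norm p x.
Proof. exact: powR_ge0. Qed.

(** The midpoint inequality for |x|^p holds in each coordinate and is strict in
some coordinate unless u = v; hence the sums over the coordinates would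
differ. *)
Lemma lp_norm_strictly_convex d p (u v : 'rV[R]_d) : (2 <= p)%N ->
  lp_norm p u = lp_norm p v -> lp_norm p (u + v) = 2 * lp_norm p u -> u = v.
Proof.
move=> p2 uv uv2; have p0 : (0 < p)%N by exact: leq_trans p2.
apply/eqP; rewrite -[_ == _]negbK; apply/negP => neq.
have [k uvk] : exists k, u 0 k != v 0 k.
  apply/existsP; rewrite -[X in is_true X]negbK negb_exists.
  apply: contra neq => /forallP H; apply/eqP/rowP => k.
  by have := H k; rewrite negbK => /eqP.
have : (lp_norm p (u + v) / 2) ^+ p < (lp_norm p u ^+ p + lp_norm p v ^+ p) / 2.
  rewrite expr_div_n !lp_normX// -big_split !mulr_suml/=.
  rewrite (bigD1 k)//= [ltRHS](bigD1 k)//=; apply: ltr_leD.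
    by rewrite mxE -expr_div_n; exact: midpoint_normX_lt.
  apply: ler_sum => i _; rewrite mxE -expr_div_n.
  have [->|uvi] := eqVneq (u 0 i) (v 0 i); last exact/ltW/midpoint_normX_lt.
  by rewrite -(mulr2n (v 0 i)) normrMn -(mulr_natr `|v 0 i|) mulfK//; lra.
by rewrite uv2 -uv (mulrC 2) mulfK//; lra.
Qed.

(** Consecutive steps have equal norms r and their sum has norm 2r, so they are
equal by strict convexity. *)
Lemma equal_steps_progression d p n (r : R) (y : nat -> 'rV[R]_d) : (2 <= p)%N ->
  (forall i j, (i < n)%N -> (j < n)%N ->
     lp_norm p (y i - y j) = r * `|i%:R - j%:R|) ->
  forall i, (i < n)%N -> y i = y 0%N + i%:R *: (y 1%N - y 0%N).
Proof.
move=> p2 ydist.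
have step i : (i.+1 < n)%N -> y i.+1 - y i = y 1%N - y 0%N.
  elim: i => [//|i IH] i2n; rewrite -IH; last exact: ltnW.
  have i1n := ltnW i2n; have i0n := ltnW i1n.
  have d1 : lp_norm p (y i.+2 - y i.+1) = r.
    by rewrite ydist// -natrB// subSnn normr1 mulr1.
  have d2 : lp_norm p (y i.+1 - y i) = r.
    by rewrite ydist// -natrB// subSnn normr1 mulr1.
  apply: (lp_norm_strictly_convex p2); first by rewrite d1 d2.
  rewrite addrA subrK d1 ydist// -natrB; last by rewrite -addn2 leq_addr.
  by rewrite -addn2 addKn normr_nat mulrC.
elim=> [|i IH] ilt; first by rewrite scale0r addr0.
by rewrite -(subrK (y i) (y i.+1)) step// IH 1?ltnW// -natr1 scalerDl scale1r addrC -addrA.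
Qed.

Lemma row_power_sum_line s p d (y w : 'rV[R]_d) : exists c : nat -> R, forall t : R,
  row_power_sum s p (y + t *: w) =
  row_power_sum s p w * t ^+ p + \sum_(k < p) c k * t ^+ k.
Proof.
exists (fun k => \sum_(m < d) (-1) ^+ s m * (y 0 m ^+ (p - k) * w 0 m ^+ k) *+ 'C(p, k)).
move=> t; rewrite /row_power_sum mulr_suml.
under [X in _ = _ + X]eq_bigr do rewrite mulr_suml.
rewrite exchange_big -big_split /=; apply: eq_bigr => m _.
rewrite !mxE exprDn big_ord_recr /= subnn expr0 mul1r binn mulr1n mulrDr addrC.
rewrite exprMn mulr_sumr; congr (_ + _); last by ring.
by apply: eq_bigr => k _; rewrite exprMn; ring.
Qed.

(** For a pattern adapted to the direction of the copy, the signed power sum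
along the copy has leading coefficient r^p = alpha + j M, so one of its values
has its integer part in [b]. *)
Lemma avoiding_set_no_copy p T (b : pred int) M (alpha : nat) d n (r : R) (j : nat) :
  (2 <= p)%N -> (1 < n)%N -> 0 <= r -> r ^+ p = (alpha + j * M)%:R ->
  (forall w : 'rV[R]_d.+1, exists s, List.In s T /\
     row_power_sum s p w = \sum_(i < d.+1) `|w 0 i| ^+ p) ->
  (forall (c : nat -> R) (j : nat), exists i : nat, (i < n)%N /\
    b (Num.floor ((alpha + j * M)%:R * i%:R ^+ p + \sum_(k < p) c k * i%:R ^+ k))) ->
  ~ contains_copy p r [set i%:R *: delta_mx 0 0 | i in `I_n] (@avoiding_set R T p b d.+1).
Proof.
move=> p2 n1 r0 rp cover hit [Y [[phi [phiPY dist]] YE]].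
have p0 : (0 < p)%N by exact: leq_trans p2.
pose y i : 'rV[R]_d.+1 := phi (i%:R *: delta_mx 0 0).
have yY i : (i < n)%N -> Y (y i).
  by move=> i_lt; apply: (set_bij_homo phiPY); exists i.
have lp_e (t : R) : lp_norm p (t *: delta_mx 0 0 : 'rV[R]_d.+1) = `|t|.
  apply/eqP; rewrite -(@eqrXn2 _ p) ?lp_norm_ge0// lp_normX//.
  rewrite (bigD1 ord0)//= !mxE eqxx mulr1 big1 ?addr0// => k k0.
  by rewrite !mxE (negbTE k0) mulr0 normr0 expr0n gtn_eqF.
have ydist i k : (i < n)%N -> (k < n)%N ->
    lp_norm p (y i - y k) = r * `|i%:R - k%:R|.
  move=> i_lt k_lt; rewrite /y dist; [|by exists i|by exists k].
  by rewrite -scalerBl lp_e.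
have yE := equal_steps_progression p2 ydist.
set w := y 1%N - y 0%N in yE.
have wp : \sum_(i < d.+1) `|w 0 i| ^+ p = (alpha + j * M)%:R.
  by rewrite -lp_normX// /w ydist ?(ltnW n1)// subr0 normr1 mulr1.
have [s [sT sw]] := cover w.
have [c cE] := row_power_sum_line s p (y 0%N) w.
have [i [i_lt bi]] := hit c j.
have := YE _ (yY i i_lt) s sT.
by rewrite yE// cE sw wp bi.
Qed.
End Geometry.

(** * Choosing the signs *)

Section Assembly.
Variable R : realType.

Definition axis_progression d n : set 'rV[R]_d.+1 :=
  [set i%:R *: delta_mx 0 0 | i in `I_n].

Lemma axis_neq0 d : delta_mx 0 0 != 0 :> 'rV[R]_d.+1.
Proof.
by apply/eqP => /rowP/(_ 0)/eqP; rewrite !mxE eqxx oner_eq0.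
Qed.

Lemma configuration_axis_progression d n : configuration n (@axis_progression d n).
Proof.
apply: inj_card_eq => i j _ _ /eqP.
rewrite -subr_eq0 -scalerBl scaler_eq0 (negbTE (axis_neq0 d)) orbF subr_eq0.
by rewrite eqr_nat => /eqP.
Qed.

Lemma axis_progression_in_line d n : in_a_line (@axis_progression d n).
Proof.
exists 0, (delta_mx 0 0); split; first exact: axis_neq0.
by move=> _ [i _ <-]; exists i%:R => //; rewrite add0r.
Qed.

(** For odd p no single pattern is adapted to all directions, hence a family. *)
Definition sign_cover p d (T : seq (nat -> bool)) :=
  forall w : 'rV[R]_d, exists s, List.In s T /\
    row_power_sum s p w = \sum_(i < d) `|w 0 i| ^+ p.

Lemma sign_cover_even p d : ~~ odd p -> sign_cover p d [:: fun=> false].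
Proof.
move=> pe w; exists (fun=> false); split; first by left.
by apply: eq_bigr => i _; rewrite mul1r -normrX ger0_norm// exprn_even_ge0.
Qed.

Definition all_signs d : seq (nat -> bool) :=
  [seq nth false t | t : d.-tuple bool <- enum {: d.-tuple bool}].

Lemma sign_cover_all p d : sign_cover p d (all_signs d).
Proof.
move=> w; pose t := [tuple odd p && (w 0 i < 0) | i < d].
exists (nth false t); split.
  have : t \in enum {: d.-tuple bool} by rewrite mem_enum.
  rewrite /all_signs; elim: (enum _) => [//|t' l IH]; rewrite inE => /orP[/eqP->|/IH].
    by left.
  by right.
apply: eq_bigr => i _; rewrite -tnth_nth tnth_mktuple.
have [podd|peven] := boolP (odd p); last by rewrite mul1r -normrX ger0_norm// exprn_even_ge0.
have [w0|w0] := ltP (w 0 i) 0; last by rewrite mul1r ger0_norm.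
by rewrite ltr0_norm// (exprNn (w 0 i)) -[in RHS](@signr_odd R p) podd.
Qed.

(** The scales r_j = (alpha + j M)^(1/p) tend to infinity while r_j^p keeps the
residue alpha modulo M. *)
Lemma copy_free_set p (T : seq (nat -> bool)) (C : R) d n M alpha b :
  (2 <= p)%N -> (1 < n)%N -> (0 < M)%N -> (0 < alpha)%N -> int_periodic M b ->
  sign_cover p d.+1 T ->
  (residue_count M b)%:R / M%:R <= C * (ln n%:R / n%:R) :> R ->
  (forall (c : nat -> R) (j : nat), exists i : nat, (i < n)%N /\
    b (Num.floor ((alpha + j * M)%:R * i%:R ^+ p + \sum_(k < p) c k * i%:R ^+ k))) ->
  exists (P : set 'rV[R]_d.+1) (r : nat -> R),
   [/\ configuration n P /\ in_a_line P,
       (forall j, 0 < r j) /\ r j @[j --> \oo] --> +oo,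
       ((1 - (size T)%:R * (C + 1) * (ln n%:R / n%:R))%:E <=
        lower_density (@avoiding_set R T p b d.+1))%E &
       forall j, ~ contains_copy p (r j) P (@avoiding_set R T p b d.+1)].
Proof.
move=> p2 n1 M0 al0 bM cover cnt hit.
have p0 : (0 < p)%N by exact: leq_trans p2.
pose r j : R := (alpha + j * M)%:R `^ (p%:R^-1).
have rX j : r j ^+ p = (alpha + j * M)%:R.
  by rewrite -powR_mulrn ?powR_ge0// -powRrM mulVf ?powRr1// pnatr_eq0 -lt0n.
have r0 j : 0 < r j by rewrite powR_gt0// ltr0n addn_gt0 al0.
exists (@axis_progression d n), r; split.
- by split; [exact: configuration_axis_progression|exact: axis_progression_in_line].
- split=> //; apply/cvgryPge => A; near=> j.
  have [A0|A0] := leP A 0; first exact: le_trans (ltW (r0 j)).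
  rewrite -(@ler_pXn2r _ p) ?nnegrE ?(ltW A0) ?(ltW (r0 j))// rX.
  apply: (@le_trans _ _ j%:R).
    by near: j; exact: nbhs_infty_ger.
  by rewrite ler_nat (leq_trans (leq_pmulr _ M0))// leq_addl.
- have ln0 : 0 < ln n%:R / n%:R :> R.
    by rewrite divr_gt0 ?ln_gt0 ?ltr1n// ltr0n ltnW.
  apply: le_trans (lower_density_avoiding_ge T d p0 M0 bM ln0).
  rewrite lee_fin lerD2l lerN2 -mulrA ler_wpM2l//.
  by rewrite mulrDl mul1r lerD2r.
- move=> j; apply: avoiding_set_no_copy (rX j) cover hit => //; exact: ltW.
Unshelve. all: by end_near.
Qed.
End Assembly.

Theorem theorem2 (R : realType) :
  (forall d p : nat, (1 <= d)%N -> (2 <= p)%N ->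
    exists C : R, 0 < C /\
    \forall n \near \oo,
      exists (E P : set 'rV[R]_d) (r : nat -> R),
      [/\ Lebesgue_measurable E,
          configuration n P /\ in_a_line P,
          (forall j, 0 < r j) /\ r j @[j --> \oo] --> +oo,
          ((1 - C * (ln n%:R / n%:R))%:E <= lower_density E)%E &
          forall j, ~ contains_copy p (r j) P E])
  /\
  (forall p : nat, (2 <= p)%N -> ~~ odd p ->
    exists C : R, 0 < C /\
    forall d : nat, (1 <= d)%N ->
    \forall n \near \oo,
      exists (E P : set 'rV[R]_d) (r : nat -> R),
      [/\ Lebesgue_measurable E /\ has_density E,
          configuration n P /\ in_a_line P,
          (forall j, 0 < r j) /\ r j @[j --> \oo] --> +oo,
          ((1 - C * (ln n%:R / n%:R))%:E <= lower_density E)%E &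
          forall j, ~ contains_copy p (r j) P E]).
Proof.
split.
  move=> [//|d] p _ p2; have p0 : (0 < p)%N by exact: leq_trans p2.
  have [C [C0 HC]] := unavoidable_residues R p0.
  exists ((size (all_signs d.+1))%:R * (C + 1)); split.
    rewrite mulr_gt0 ?addr_gt0// ltr0n size_map -cardE card_tuple expn_gt0.
    by rewrite card_bool.
  near=> n; have pn : (p.+2 < n)%N by near: n; exact: nbhs_infty_gt.
  have [M [alpha [b [M0 al0 bM cnt hit]]]] := HC n pn.
  have n1 : (1 < n)%N by apply: leq_ltn_trans pn.
  have [P [r [HP Hr Hd Hc]]] :=
    copy_free_set p2 n1 M0 al0 bM (@sign_cover_all R p d.+1) cnt hit.
  exists (@avoiding_set R (all_signs d.+1) p b d.+1), P, r; split=> //.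
  by apply: Lebesgue_measurable_borel; exact: measurable_avoiding_set.
move=> p p2 peven; have p0 : (0 < p)%N by exact: leq_trans p2.
have [C [C0 HC]] := unavoidable_residues R p0.
exists (C + 1); split; first by rewrite addr_gt0.
move=> [//|d] _.
near=> n; have pn : (p.+2 < n)%N by near: n; exact: nbhs_infty_gt.
have [M [alpha [b [M0 al0 bM cnt hit]]]] := HC n pn.
have n1 : (1 < n)%N by apply: leq_ltn_trans pn.
have [P [r [HP Hr Hd Hc]]] :=
  copy_free_set p2 n1 M0 al0 bM (@sign_cover_even R p d.+1 peven) cnt hit.
exists (@avoiding_set R [:: fun=> false] p b d.+1), P, r; split=> //.
- split; last exact: has_density_avoiding1 p0 M0 bM.
  by apply: Lebesgue_measurable_borel; exact: measurable_avoiding_set.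
- by move: Hd; rewrite mul1r.
Unshelve. all: by end_near.
Qed.
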